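(* The capacity region of the finite-alphabet cognitive MAC $P_{Y|X_1,X_2}$ with decoding metric $q(x_1,x_2,y)$ contains the closure of the convex hull of $\bigcup_P\tilde{\mathcal R}^{sup}_{cog}(P)$, the union being over all distributions $P$ on $\mathcal X_1\times\mathcal X_2\times\mathcal Y$ of the form $P=P_{X_1,X_2}P_{Y|X_1,X_2}$ with $P_{Y|X_1,X_2}$ the channel, where $$\tilde{\mathcal R}^{sup}_{cog}(P)=\Big\{(R_1,R_2):\ R_2\le\min_{\tilde P\in\mathcal L_2(P)}I_{\tilde P}(X_2;Y|X_1),\ R_1+R_2\le\min_{\tilde P\in\mathcal L_0(P):\,I_{\tilde P}(X_1;Y)\le R_1}I_{\tilde P}(X_1,X_2;Y)\Big\}.$$
   Context: Cognitive MAC with mismatched decoding: finite alphabets $\mathcal X_1,\mathcal X_2,\mathcal Y$, memoryless channel $P_{Y|X_1,X_2}$, metric $q$. A blocklength-$n$ code of rates $(R_1,R_2)$ has encoder 1 mapping $W_1\in\{1,\dots,2^{nR_1}\}$ to $\mathbf x_1(W_1)\in\mathcal X_1^n$ and encoder 2 mapping $(W_1,W_2)$, $W_2\in\{1,\dots,2^{nR_2}\}$, to $\mathbf x_2(W_1,W_2)\in\mathcal X_2^n$; messages are uniform. The decoder outputs $(i,j)$ iff $\sum_t q(x_{1,t}(i),x_{2,t}(i,j),y_t)>\sum_t q(x_{1,t}(i'),x_{2,t}(i',j'),y_t)$ for all $(i',j')\neq(i,j)$, else error. A rate pair is achievable if there are codes with average error probability tending to zero; the capacity region is the closure of the set of achievable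 pairs. For a distribution $Q$: $\mathcal G_q(Q)=\{f: f_{X_1,X_2}=Q_{X_1,X_2},\ \mathbb E_f q\ge\mathbb E_Q q\}$; $\mathcal L_2(Q)=\{f\in\mathcal G_q(Q):f_{X_1,Y}=Q_{X_1,Y}\}$; $\mathcal L_0(Q)=\{f\in\mathcal G_q(Q):f_Y=Q_Y\}$. *)

(* Defs.v *)
From HB Require Import structures.
From mathcomp Require Import all_boot all_order all_algebra.
From mathcomp Require Import all_classical all_reals all_analysis.
Set Implicit Arguments. Unset Strict Implicit. Unset Printing Implicit Defensive.
Import Order.TTheory GRing.Theory Num.Theory.
Import numFieldNormedType.Exports.
Local Open Scope classical_set_scope.
Local Open Scope ring_scope.

Section CogMAC.
Variables (R : realType) (X1 X2 Y : finType).

Definition log2 (x : R) : R := ln x / ln 2.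

Definition dist3 := X1 -> X2 -> Y -> R.

Definition is_dist3 (f : dist3) : Prop :=
  (forall a b c, 0 <= f a b c) /\ \sum_a \sum_b \sum_c f a b c = 1.

Definition is_dist2 (p : X1 -> X2 -> R) : Prop :=
  (forall a b, 0 <= p a b) /\ \sum_a \sum_b p a b = 1.

Definition is_channel (W : X1 -> X2 -> Y -> R) : Prop :=
  (forall a b c, 0 <= W a b c) /\ (forall a b, \sum_c W a b c = 1).

Definition m12 (f : dist3) a b : R := \sum_c f a b c.
Definition m13 (f : dist3) a c : R := \sum_b f a b c.
Definition m1 (f : dist3) a : R := \sum_b \sum_c f a b c.
Definition m3 (f : dist3) c : R := \sum_a \sum_b f a b c.

Definition Eq (q : X1 -> X2 -> Y -> R) (f : dist3) : R :=
  \sum_a \sum_b \sum_c f a b c * q a b c.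

Definition Gq q (Q f : dist3) : Prop :=
  is_dist3 f /\ (forall a b, m12 f a b = m12 Q a b) /\ Eq q Q <= Eq q f.
Definition L2 q (Q f : dist3) : Prop :=
  Gq q Q f /\ (forall a c, m13 f a c = m13 Q a c).
Definition L0 q (Q f : dist3) : Prop :=
  Gq q Q f /\ (forall c, m3 f c = m3 Q c).

Definition MI_X2Y_given_X1 (f : dist3) : R :=
  \sum_a \sum_b \sum_c
    (if f a b c == 0 then 0 else
       f a b c * log2 (f a b c * m1 f a / (m12 f a b * m13 f a c))).
Definition MI_X1Y (f : dist3) : R :=
  \sum_a \sum_c
    (if m13 f a c == 0 then 0 else
       m13 f a c * log2 (m13 f a c / (m1 f a * m3 f c))).
Definition MI_X1X2Y (f : dist3) : R :=
  \sum_a \sum_b \sum_c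
    (if f a b c == 0 then 0 else
       f a b c * log2 (f a b c / (m12 f a b * m3 f c))).

Definition joint (PX : X1 -> X2 -> R) (W : X1 -> X2 -> Y -> R) : dist3 :=
  fun a b c => PX a b * W a b c.

(* \tilde R^{sup}_{cog}(P); minima written as infima in \bar R
   (infimum of the empty set is +oo); rates are nonnegative *)
Definition L0_below q (P : dist3) (r1 : R) : set dist3 :=
  [set f | L0 q P f /\ MI_X1Y f <= r1].

Definition Rcog q (P : dist3) : set (R * R) :=
  [set r | 0 <= r.1 /\ 0 <= r.2 /\
     (r.2%:E <= ereal_inf [set (MI_X2Y_given_X1 f)%:E | f in L2 q P])%E /\
     ((r.1 + r.2)%:E <=
        ereal_inf [set (MI_X1X2Y f)%:E | f in L0_below q P r.1])%E].

Record code (n M1 M2 : nat) := Code {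
  enc1 : 'I_M1 -> 'I_n -> X1 ;
  enc2 : 'I_M1 -> 'I_M2 -> 'I_n -> X2 }.

Definition score q n M1 M2 (c : code n M1 M2) (i : 'I_M1) (j : 'I_M2)
    (y : {ffun 'I_n -> Y}) : R :=
  \sum_(t < n) q (enc1 c i t) (enc2 c i j t) (y t).

Definition decode_ok q n M1 M2 (c : code n M1 M2) (w1 : 'I_M1) (w2 : 'I_M2)
    (y : {ffun 'I_n -> Y}) : bool :=
  [forall i : 'I_M1, forall j : 'I_M2,
     ((i, j) != (w1, w2)) ==> (score q c i j y < score q c w1 w2 y)].

Definition perr (W : X1 -> X2 -> Y -> R) q n M1 M2 (c : code n M1 M2) : R :=
  (M1 * M2)%:R^-1 *
  \sum_(w1 : 'I_M1) \sum_(w2 : 'I_M2) \sum_(y : {ffun 'I_n -> Y})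
     (\prod_(t < n) W (enc1 c w1 t) (enc2 c w1 w2 t) (y t)) *
     (if decode_ok q c w1 w2 y then 0 else 1).

Definition msgs (n : nat) (r : R) : nat := `|Num.ceil (2 `^ (n%:R * r))|%N.

Definition achievable W q (r : R * R) : Prop :=
  0 <= r.1 /\ 0 <= r.2 /\
  exists c : forall n, code n (msgs n r.1) (msgs n r.2),
    (fun n => perr W q (c n)) @ \oo --> (0 : R).

Definition capacity_region W q : set (R * R) :=
  @closure (R * R)%type [set r | achievable W q r].

Definition conv_hull (A : set (R * R)) : set (R * R) :=
  [set p | exists k (l : 'I_k -> R) (a : 'I_k -> R * R),
     (forall i, 0 <= l i) /\ \sum_i l i = 1 /\ (forall i, A (a i)) /\
     p = (\sum_i l i * (a i).1, \sum_i l i * (a i).2)].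

Definition union_Rcog W q : set (R * R) :=
  [set r | exists PX, is_dist2 PX /\ Rcog q (joint PX W) r].

End CogMAC.

(* Main.v *)
(* Superposition coding. For an input law PX, cloud centres are drawn from the
   product law of X1 and satellites from the conditional product law of X2, both
   conditioned on the pair being typical. An error of type f (the joint type
   of a wrong pair of codewords with the output) needs f to be nearly in L2(P)
   when only the second message is wrong, and nearly in L0(P) otherwise. The first
   kind has probability at most 2^(n (R2 - I_f(X2;Y|X1))). The second is bounded
   both through the cloud centres alone, by 2^(n (R1 - I_f(X1;Y))), and through
   the pairs, by 2^(n (R1 + R2 - I_f(X1,X2;Y))); hence only types with
   I_f(X1;Y) <= R1 constrain the sum rate. Compactness of the set of joint laws
   turns the strict inequalities on L0(P) and L2(P) into a uniform exponent, and
   there are only polynomially many types. Convex combinations are reached by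
   concatenating codes: scores add up, so the concatenation is decoded correctly
   as soon as both parts are. *)

Require Import Defs.
From HB Require Import structures.
From mathcomp Require Import all_boot all_order all_algebra.
From mathcomp Require Import all_classical all_reals all_analysis.
From mathcomp Require Import ring lra.
Import Order.TTheory GRing.Theory Num.Theory.
Import numFieldNormedType.Exports.
Local Open Scope classical_set_scope.
Local Open Scope ring_scope.
Set Implicit Arguments.
Unset Strict Implicit.
Unset Printing Implicit Defensive.

(** * Product sums and ensembles of codes *)

(** [L0] and [L2] prescribe the input marginal exactly, whereas unrestricted i.i.d. codewords would
    let wrong pairs of atypical input type win with too large a probability. Conditioning on
    typicality removes such rivals. For a centre most of whose satellites are typical, the
    conditioning multiplies the satellite law by at most 2; such centres carry at least half of the
    mass, so the centre law also grows by at most 2. All exponents can thus be computed with the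
    product laws, at the price of the factors 2 and 4 met below. The satellites of a wrong cloud are
    treated as one event. Its probability can then be bounded by that of its centre, with no factor
    for the number of satellites. Wrong pairs satisfy the constraints of [L0] and [L2] only up to
    the typicality tolerance. The sets are therefore replaced by continuous nonnegative slacks whose
    zeros lie in them. *)

Section FiniteProducts.
Variable R : realType.

Lemma sum_prod_ffun (I T : finType) (F : I -> T -> R) :
  \sum_(x : {ffun I -> T}) \prod_i F i (x i) = \prod_i \sum_a F i a.
Proof. by rewrite bigA_distr_bigA. Qed.

Lemma sum_delta (T : finType) (b : T) (F : T -> R) :
  \sum_a (b == a)%:R * F a = F b.
Proof.
rewrite (bigD1 b) //= eqxx mul1r big1 ?addr0 // => a ab.
by rewrite eq_sym (negbTE ab) mul0r.
Qed.

Lemma prod_marginal1 (I T : finType) (nu : T -> R) (w : I) (G : T -> R) :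
  \sum_a nu a = 1 ->
  \sum_(K : {ffun I -> T}) (\prod_i nu (K i)) * G (K w) = \sum_k nu k * G k.
Proof.
move=> nu1.
pose F i a := nu a * (if i == w then G a else 1).
transitivity (\sum_(K : {ffun I -> T}) \prod_i F i (K i)).
  apply: eq_bigr => K _; rewrite big_split /=; congr (_ * _).
  by rewrite -big_mkcond big_pred1_eq.
rewrite sum_prod_ffun (bigD1 w) //= /F eqxx [X in _ * X]big1 ?mulr1 //.
by move=> i /negbTE ->; rewrite -[RHS]nu1; apply: eq_bigr => a _; rewrite mulr1.
Qed.

(** [G] couples two coordinates, so the summand is not a product over [I]. It becomes one once the
    value [l] of [K v] is fixed by an indicator. *)
Lemma prod_marginal2 (I T : finType) (nu : T -> R) (w v : I) (G : T -> T -> R) :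
  \sum_a nu a = 1 -> w != v ->
  \sum_(K : {ffun I -> T}) (\prod_i nu (K i)) * G (K w) (K v)
  = \sum_k nu k * \sum_l nu l * G k l.
Proof.
move=> nu1 wv.
have step l : \sum_(K : {ffun I -> T})
    (\prod_i nu (K i)) * (G (K w) l * (K v == l)%:R)
    = (\sum_k nu k * G k l) * nu l.
  pose F i a := nu a * ((if i == w then G a l else 1)
    * (if i == v then (a == l)%:R else 1)).
  transitivity (\sum_(K : {ffun I -> T}) \prod_i F i (K i)).
    apply: eq_bigr => K _; rewrite big_split /= big_split /=.
    by congr (_ * (_ * _)); rewrite -big_mkcond big_pred1_eq.
  rewrite sum_prod_ffun (bigD1 w) //= (bigD1 v) 1?eq_sym //= /F !eqxx.
  rewrite (negbTE wv) eq_sym (negbTE wv) [X in _ * (_ * X)]big1; last first.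
    move=> i /andP[/negbTE -> /negbTE ->]; rewrite -[RHS]nu1.
    by apply: eq_bigr => a _; rewrite !mulr1.
  rewrite mulr1; congr (_ * _); first by apply: eq_bigr => k _; rewrite mulr1.
  rewrite -[RHS](sum_delta l nu); apply: eq_bigr => a _.
  by rewrite mul1r mulrC eq_sym.
transitivity (\sum_l (\sum_k nu k * G k l) * nu l).
  rewrite -(eq_bigr _ (fun l _ => step l)) exchange_big /=.
  apply: eq_bigr => K _; rewrite -big_distrr /=; congr (_ * _).
  rewrite -(sum_delta (K v) (G (K w))); apply: eq_bigr => l _.
  by rewrite mulrC.
under eq_bigr do rewrite mulr_suml.
rewrite exchange_big /=.
apply: eq_bigr => k _; rewrite mulr_sumr; apply: eq_bigr => l _.
by rewrite mulrAC mulrA.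
Qed.

Definition zip2 (I A B : finType) (x : {ffun I -> A}) (y : {ffun I -> B}) :
  {ffun I -> A * B} := [ffun t => (x t, y t)].

Lemma sum_zip2 (I A B : finType) (F : {ffun I -> A * B} -> R) :
  \sum_z F z = \sum_x \sum_y F (zip2 x y).
Proof.
rewrite pair_bigA /= (reindex (fun p : _ * _ => zip2 p.1 p.2)) //=.
exists (fun z : {ffun I -> A * B} => ([ffun t => (z t).1], [ffun t => (z t).2])).
  by move=> [x y] _; congr (_, _); apply/ffunP => t; rewrite !ffunE.
by move=> z _; apply/ffunP => t; rewrite !ffunE -surjective_pairing.
Qed.

Lemma sum_split_ffun (n1 n2 : nat) (T : finType)
    (F : {ffun 'I_n1 -> T} -> {ffun 'I_n2 -> T} -> R) :
  \sum_(y : {ffun 'I_(n1 + n2) -> T})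
     F [ffun t => y (lshift n2 t)] [ffun t => y (rshift n1 t)]
  = \sum_y1 \sum_y2 F y1 y2.
Proof.
rewrite pair_bigA /= (reindex (fun y : {ffun 'I_(n1 + n2) -> T} =>
  ([ffun t => y (lshift n2 t)], [ffun t => y (rshift n1 t)]))) //=.
exists (fun p : {ffun 'I_n1 -> T} * {ffun 'I_n2 -> T} =>
  [ffun t : 'I_(n1 + n2) =>
    match fintype.split t with inl s => p.1 s | inr s => p.2 s end]).
  move=> y _; apply/ffunP => t; rewrite ffunE /= -{2}(splitK t).
  by case: (fintype.split t) => s; rewrite ffunE.
move=> [x y] _; congr (_, _); apply/ffunP => t; rewrite !ffunE.
  by rewrite (unsplitK (inl t)).
by rewrite (unsplitK (inr t)).
Qed.

End FiniteProducts.

Section Ensembles.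
Variables (R : realType) (X1 X2 Y : finType).
Variables (W q : X1 -> X2 -> Y -> R).

Definition msg_err n M1 M2 (c : Defs.code X1 X2 n M1 M2) w1 w2 : R :=
  \sum_(y : {ffun 'I_n -> Y})
     (\prod_(t < n) W (enc1 c w1 t) (enc2 c w1 w2 t) (y t)) *
     (if decode_ok q c w1 w2 y then 0 else 1).

(* The bound is required for each message pair rather than on average, so that
   it survives restriction to any sub-code and concatenation of codes. *)
Definition ensemble n M1 M2 (eps : R) : Prop :=
  exists (Om : finType) (mu : Om -> R) (c : Om -> Defs.code X1 X2 n M1 M2),
    [/\ forall o, 0 <= mu o, \sum_o mu o = 1 &
        forall w1 w2, \sum_o mu o * msg_err (c o) w1 w2 <= eps].

Lemma ensemble_perr n M1 M2 eps : (0 < M1)%N -> (0 < M2)%N ->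
  ensemble n M1 M2 eps -> exists c : Defs.code X1 X2 n M1 M2, perr W q c <= eps.
Proof.
move=> M10 M20 [Om [mu [c [mu0 mu1 err]]]].
apply: contrapT => /forallNP big.
have M0 : (0 : R) < (M1 * M2)%:R by rewrite ltr0n muln_gt0 M10.
have : \sum_o mu o * perr W q (c o) <= eps.
  have -> : \sum_o mu o * perr W q (c o) = (M1 * M2)%:R^-1 *
      \sum_(w1 < M1) \sum_(w2 < M2) \sum_o mu o * msg_err (c o) w1 w2.
    under [in RHS]eq_bigr do rewrite exchange_big /=.
    rewrite exchange_big /= mulr_sumr; apply: eq_bigr => o _.
    rewrite /perr mulrCA; congr (_ * _); rewrite mulr_sumr.
    by apply: eq_bigr => w1 _; rewrite mulr_sumr.
  rewrite ler_pdivrMl //.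
  apply: (@le_trans _ _ (\sum_(w1 < M1) \sum_(w2 < M2) eps)).
    by apply: ler_sum => w1 _; apply: ler_sum => w2 _.
  by rewrite !sumr_const !card_ord -mulrnA mulr_natl mulnC.
apply/negP; rewrite -ltNge.
have big' o : eps < perr W q (c o) by rewrite ltNge; apply/negP/big.
rewrite -[ltLHS]mul1r -mu1 mulr_suml -subr_gt0 -sumrB.
rewrite lt_def sumr_ge0 ?andbT; last first.
  by move=> o _; rewrite -mulrBr mulr_ge0 // subr_ge0 ltW.
apply/negP; rewrite psumr_eq0; last first.
  by move=> o _; rewrite -mulrBr mulr_ge0 // subr_ge0 ltW.
(* Every code exceeds [eps] strictly, so equality of the averages would force all weights to
   vanish. *)
move=> /allP z; have : \sum_o mu o = 0.
  apply: big1 => o _; have := z o (mem_index_enum _); rewrite /= -mulrBr.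
  by rewrite mulf_eq0 subr_eq0 (gt_eqF (big' o)) orbF => /eqP.
by rewrite mu1 => /eqP; rewrite oner_eq0.
Qed.

Hypothesis Wch : is_channel W.

Lemma Wn_sum1 n (x1 : 'I_n -> X1) (x2 : 'I_n -> X2) :
  \sum_(y : {ffun 'I_n -> Y}) \prod_t W (x1 t) (x2 t) (y t) = 1.
Proof.
by rewrite (sum_prod_ffun (fun t => W (x1 t) (x2 t))) big1 // => t _; apply: Wch.2.
Qed.

Lemma Wn_ge0 n (x1 : 'I_n -> X1) (x2 : 'I_n -> X2) (y : 'I_n -> Y) :
  0 <= \prod_t W (x1 t) (x2 t) (y t).
Proof. by apply: prodr_ge0 => t _; apply: Wch.1. Qed.

Lemma ensemble_le n M1 M2 e e' : e <= e' ->
  ensemble n M1 M2 e -> ensemble n M1 M2 e'.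
Proof.
move=> ee' [Om [mu [c [mu0 mu1 err]]]]; exists Om, mu, c; split => // w1 w2.
exact: le_trans (err w1 w2) ee'.
Qed.

Lemma ord_pair_inj (M A B : nat) : (M <= A * B)%N ->
  {phi : 'I_M -> 'I_A * 'I_B | injective phi}.
Proof.
move=> MAB; have MAB' : (M <= #|{: 'I_A * 'I_B}|)%N by rewrite card_prod !card_ord.
exists (fun i => enum_val (widen_ord MAB' i)).
by move=> i j /enum_val_inj /(congr1 val) /= /val_inj.
Qed.

Section Concatenation.
Variables (n1 n2 A1 A2 B1 B2 M1 M2 : nat).
Variables (phi1 : 'I_M1 -> 'I_A1 * 'I_B1) (phi2 : 'I_M2 -> 'I_A2 * 'I_B2).
Hypotheses (phi1I : injective phi1) (phi2I : injective phi2).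
Variables (c : Defs.code X1 X2 n1 A1 A2) (d : Defs.code X1 X2 n2 B1 B2).

Definition code_cat : Defs.code X1 X2 (n1 + n2) M1 M2 :=
  Code (fun i t => match fintype.split t with
                   | inl s => enc1 c (phi1 i).1 s
                   | inr s => enc1 d (phi1 i).2 s end)
       (fun i j t => match fintype.split t with
                   | inl s => enc2 c (phi1 i).1 (phi2 j).1 s
                   | inr s => enc2 d (phi1 i).2 (phi2 j).2 s end).

Lemma score_cat i j (y : {ffun _ -> _}) : score q code_cat i j y =
  score q c (phi1 i).1 (phi2 j).1 [ffun t => y (lshift n2 t)] +
  score q d (phi1 i).2 (phi2 j).2 [ffun t => y (rshift n1 t)].
Proof.
rewrite /score big_split_ord /=; congr (_ + _); apply: eq_bigr => t _.
  by rewrite (unsplitK (inl t)) ffunE.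
by rewrite (unsplitK (inr t)) ffunE.
Qed.

Lemma decode_ok_cat w1 w2 (y : {ffun _ -> _}) :
  decode_ok q c (phi1 w1).1 (phi2 w2).1 [ffun t => y (lshift n2 t)] ->
  decode_ok q d (phi1 w1).2 (phi2 w2).2 [ffun t => y (rshift n1 t)] ->
  decode_ok q code_cat w1 w2 y.
Proof.
move=> ok1 ok2; apply/forallP => i; apply/forallP => j; apply/implyP => neq.
rewrite !score_cat.
have lt1 := implyP (forallP (forallP ok1 (phi1 i).1) (phi2 j).1).
have lt2 := implyP (forallP (forallP ok2 (phi1 i).2) (phi2 j).2).
(* A wrong message pair may be right in one part, where the scores tie, but by injectivity not in
   both; the other part supplies the strict inequality. *)
have [e1|ne1] := eqVneq ((phi1 i).1, (phi2 j).1) ((phi1 w1).1, (phi2 w2).1);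
have [e2|ne2] := eqVneq ((phi1 i).2, (phi2 j).2) ((phi1 w1).2, (phi2 w2).2).
- case/negP: neq; apply/eqP; case: e1 => e1 e1'; case: e2 => e2 e2'.
  congr (_, _); first apply: phi1I; last apply: phi2I.
    by rewrite [LHS]surjective_pairing e1 e2 -surjective_pairing.
  by rewrite [LHS]surjective_pairing e1' e2' -surjective_pairing.
- by case: e1 => -> ->; rewrite ltrD2l; apply: lt2.
- by case: e2 => -> ->; rewrite ltrD2r; apply: lt1.
- by apply: ltrD; [apply: lt1|apply: lt2].
Qed.

Lemma msg_err_cat w1 w2 : msg_err code_cat w1 w2 <=
  msg_err c (phi1 w1).1 (phi2 w2).1 + msg_err d (phi1 w1).2 (phi2 w2).2.
Proof.
pose P1 (y : {ffun 'I_n1 -> Y}) :=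
  \prod_t W (enc1 c (phi1 w1).1 t) (enc2 c (phi1 w1).1 (phi2 w2).1 t) (y t).
pose P2 (y : {ffun 'I_n2 -> Y}) :=
  \prod_t W (enc1 d (phi1 w1).2 t) (enc2 d (phi1 w1).2 (phi2 w2).2 t) (y t).
pose e1 y : R := if decode_ok q c (phi1 w1).1 (phi2 w2).1 y then 0 else 1.
pose e2 y : R := if decode_ok q d (phi1 w1).2 (phi2 w2).2 y then 0 else 1.
(* Both errors are lifted to the joint output, the foreign block summing to 1. The union bound then
   becomes a pointwise comparison of indicators. *)
have -> : msg_err c (phi1 w1).1 (phi2 w2).1 + msg_err d (phi1 w1).2 (phi2 w2).2
    = \sum_y1 \sum_y2 P1 y1 * P2 y2 * (e1 y1 + e2 y2).
  under eq_bigr do under eq_bigr do rewrite mulrDr.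
  under eq_bigr do rewrite big_split.
  rewrite big_split /=; congr (_ + _).
    apply: eq_bigr => y1 _.
    under eq_bigr do rewrite mulrAC.
    by rewrite -mulr_sumr /P2 Wn_sum1 mulr1.
  rewrite [RHS]exchange_big; apply: eq_bigr => y2 _ /=.
  under [RHS]eq_bigr do rewrite -mulrA.
  by rewrite -mulr_suml /P1 Wn_sum1 mul1r.
rewrite -(sum_split_ffun (fun y1 y2 => P1 y1 * P2 y2 * (e1 y1 + e2 y2))).
apply: ler_sum => y _; rewrite big_split_ord /=.
have -> : \prod_(t < n1) W (enc1 code_cat w1 (lshift n2 t))
    (enc2 code_cat w1 w2 (lshift n2 t)) (y (lshift n2 t))
    = P1 [ffun t => y (lshift n2 t)].
  by apply: eq_bigr => t _; rewrite /= (unsplitK (inl t)) ffunE.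
have -> : \prod_(t < n2) W (enc1 code_cat w1 (rshift n1 t))
    (enc2 code_cat w1 w2 (rshift n1 t)) (y (rshift n1 t))
    = P2 [ffun t => y (rshift n1 t)].
  by apply: eq_bigr => t _; rewrite /= (unsplitK (inr t)) ffunE.
apply: ler_wpM2l; first by rewrite mulr_ge0 ?Wn_ge0.
have := @decode_ok_cat w1 w2 y; rewrite /e1 /e2.
case: (decode_ok q c _ _ _) => //; case: (decode_ok q d _ _ _) => //;
case: (decode_ok q code_cat _ _ _) => //; rewrite ?addr0 ?add0r ?ler01 //;
by [move=> /(_ erefl erefl)|move=> _; lra].
Qed.

End Concatenation.

Lemma ensemble_cat n1 n2 A1 A2 B1 B2 M1 M2 e1 e2 :
  (M1 <= A1 * B1)%N -> (M2 <= A2 * B2)%N ->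
  ensemble n1 A1 A2 e1 -> ensemble n2 B1 B2 e2 ->
  ensemble (n1 + n2) M1 M2 (e1 + e2).
Proof.
move=> /ord_pair_inj[phi1 phi1I] /ord_pair_inj[phi2 phi2I].
move=> [Om [mu [c [mu0 mu1 errc]]]] [Pi [nu [d [nu0 nu1 errd]]]].
exists (Om * Pi)%type, (fun p => mu p.1 * nu p.2),
  (fun p => code_cat phi1 phi2 (c p.1) (d p.2)); split.
- by move=> p; rewrite mulr_ge0.
- rewrite -(pair_bigA _ (fun o p => mu o * nu p)) /=.
  by rewrite -[RHS]mu1; apply: eq_bigr => o _; rewrite -mulr_sumr nu1 mulr1.
move=> w1 w2.
pose E1 o := msg_err (c o) (phi1 w1).1 (phi2 w2).1.
pose E2 p := msg_err (d p) (phi1 w1).2 (phi2 w2).2.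
apply: (@le_trans _ _ (\sum_o \sum_p mu o * nu p * (E1 o + E2 p))).
  rewrite pair_bigA /=; apply: ler_sum => p _; apply: ler_wpM2l.
    by rewrite mulr_ge0.
  exact: msg_err_cat.
have -> : \sum_o \sum_p mu o * nu p * (E1 o + E2 p) =
    \sum_o mu o * E1 o + \sum_p nu p * E2 p.
  under eq_bigr do under eq_bigr do rewrite mulrDr.
  under eq_bigr do rewrite big_split.
  rewrite big_split /=; congr (_ + _).
    apply: eq_bigr => o _.
    under eq_bigr do rewrite mulrAC.
    by rewrite -mulr_sumr nu1 mulr1.
  rewrite exchange_big; apply: eq_bigr => p _ /=.
  under [LHS]eq_bigr do rewrite -mulrA.
  by rewrite -mulr_suml mu1 mul1r.
by apply: lerD; [exact: errc|exact: errd].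
Qed.

End Ensembles.

(** * Time sharing *)

Section TimeSharing.
Variable R : realType.

(* The maximum with 1 always allows a single message, even at negative rates. *)
Definition size_le (n : nat) (r : R) (M : nat) : Prop :=
  M%:R <= Num.max 1 (2 `^ (n%:R * r)).

Definition max_size (n : nat) (r : R) : nat :=
  Num.truncn (Num.max 1 (2 `^ (n%:R * r))).

Lemma size_le_max n r : size_le n r (max_size n r).
Proof. by rewrite /size_le /max_size truncn_le // le_max ler01. Qed.

Lemma max_size_gt0 n r : (0 < max_size n r)%N.
Proof. by rewrite /max_size truncn_gt0 le_max lexx. Qed.

(** The floor loses less than 1, and [max_size] is at least 1. *)
Lemma max_size_half n r : 2 `^ (n%:R * r) <= 2 * (max_size n r)%:R.
Proof.
have := truncnS_gt (Num.max 1 (2 `^ (n%:R * r))); rewrite -/(max_size n r).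
rewrite gt_max => /andP[_ lt]; apply: le_trans (ltW lt) _.
by have := max_size_gt0 n r; rewrite -(ler_nat R) -natr1; lra.
Qed.

Lemma powR2D (x y : R) : 2 `^ (x + y) = 2 `^ x * 2 `^ y.
Proof. by apply: powRD; rewrite pnatr_eq0 implybT. Qed.

Lemma powR2_mono (x y : R) : x <= y -> 2 `^ x <= 2 `^ y.
Proof. by apply: ler_powR; rewrite ler1n. Qed.

(** Half of [eta] is spent in the two parts. The other half, [n * eta / 2] bits, pays for the two
    floors (2 bits) and for rounding [l * n] to [n1] (at most [r + s] bits). *)
Lemma max_size_mul (r s l eta : R) (n n1 n2 M : nat) :
  0 <= r -> 0 <= s -> (n1 + n2 = n)%N ->
  n1%:R <= l * n%:R < n1%:R + 1 -> 2 + r + s <= n%:R * (eta / 2) ->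
  size_le n (l * r + (1 - l) * s - eta) M ->
  (M <= max_size n1 (r - eta / 2) * max_size n2 (s - eta / 2))%N.
Proof.
move=> r0 s0 nE /andP[le1 lt1] big; rewrite /size_le le_max => /orP[M1|Mle].
  have {}M1 : (M <= 1)%N by rewrite -(ler_nat R).
  apply: leq_trans M1 _.
  by rewrite muln_gt0 !max_size_gt0.
rewrite -(ler_nat R) natrM; apply: le_trans Mle _.
rewrite -(@ler_pM2l _ 4) //.
have -> : 4 * ((max_size n1 (r - eta / 2))%:R * (max_size n2 (s - eta / 2))%:R)
  = 2 * (max_size n1 (r - eta / 2))%:R * (2 * (max_size n2 (s - eta / 2))%:R) :> R.
  ring.
apply: le_trans (ler_pM (powR_ge0 _ _) (powR_ge0 _ _)
  (max_size_half _ _) (max_size_half _ _)).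
have -> : 4 = 2 `^ 2 :> R by rewrite powR_mulrn // -natrX.
rewrite -!powR2D; apply: powR2_mono.
have nE' : n2%:R = n%:R - n1%:R :> R by rewrite -nE natrD; ring.
(* [th] is the fraction of a channel use moved from the first part to the second; it changes the
   exponent by [th * (r - s)]. *)
rewrite nE'; set th := l * n%:R - n1%:R.
have -> : n1%:R = l * n%:R - th by rewrite /th; ring.
have th0 : 0 <= th by rewrite /th; lra.
have th1 : th <= 1 by rewrite /th; lra.
have : th * (r - s) <= r + s by nra.
lra.
Qed.

Lemma closure_pair (A : set (R * R)) (p : R * R) :
  (forall e, 0 < e -> exists p', [/\ A p', `|p.1 - p'.1| < e & `|p.2 - p'.2| < e]) ->
  @closure (R * R)%type A p.
Proof.
move=> near B /nbhs_ballP[e e0 eB]; have [p' [Ap' p1 p2]] := near e e0.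
by exists p'; split => //; apply: eB; split; apply: p1 || apply: p2.
Qed.

Variables (X1 X2 Y : finType) (W q : X1 -> X2 -> Y -> R).
Hypothesis Wch : is_channel W.

(** All large [n] and all admissible sizes are demanded, because time sharing invokes the property
    at rounded lengths and floored sizes. *)
Definition ensemble_achievable (r : R * R) : Prop :=
  [/\ 0 <= r.1, 0 <= r.2 &
   forall eps eta, 0 < eps -> 0 < eta -> exists N, forall n, (N <= n)%N ->
   forall M1 M2, size_le n (r.1 - eta) M1 -> size_le n (r.2 - eta) M2 ->
   ensemble W q n M1 M2 eps].

Lemma exists_nat_ge (x : R) : exists N : nat, forall n, (N <= n)%N -> x <= n%:R.
Proof.
exists (Num.truncn x).+1 => n Nn; apply: le_trans (ltW (truncnS_gt x)) _.
by rewrite ler_nat.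
Qed.

Lemma ensemble_achievable_convex (r s : R * R) (l : R) : 0 <= l <= 1 ->
  ensemble_achievable r -> ensemble_achievable s ->
  ensemble_achievable (l * r.1 + (1 - l) * s.1, l * r.2 + (1 - l) * s.2).
Proof.
move=> /andP[l0 l1] rA sA.
(* The endpoints are set apart since the thresholds below divide by [l] and [1 - l]. *)
have [->|lN0] := eqVneq l 0.
  by rewrite !subr0 !mul0r !mul1r !add0r -surjective_pairing.
have [->|lN1] := eqVneq l 1.
  by rewrite !subrr !mul0r !mul1r !addr0 -surjective_pairing.
have lp : 0 < l by rewrite lt_def lN0.
have lp' : 0 < 1 - l by rewrite subr_gt0 lt_def eq_sym lN1.
case: rA => r10 r20 rA; case: sA => s10 s20 sA; split => /=.
- by rewrite addr_ge0 // mulr_ge0 // ltW.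
- by rewrite addr_ge0 // mulr_ge0 // ltW.
move=> eps eta eps0 eta0.
have eps20 : 0 < eps / 2 by lra.
have eta20 : 0 < eta / 2 by lra.
have [Nr hr] := rA _ _ eps20 eta20; have [Ns hs] := sA _ _ eps20 eta20.
(* [Na] and [Nb] make both parts long enough, the [+ 1] covering the floor in [n1]. [Nc] is the
   threshold of [max_size_mul] for both users at once. *)
have [Na ha] := exists_nat_ge ((Nr%:R + 1) / l).
have [Nb hb] := exists_nat_ge (Ns%:R / (1 - l)).
have [Nc hc] := exists_nat_ge ((2 + (r.1 + r.2) + (s.1 + s.2)) / (eta / 2)).
exists (maxn Na (maxn Nb Nc)) => n; rewrite !geq_max => /and3P[na nb nc].
move: (ha _ na) (hb _ nb) (hc _ nc); rewrite !ler_pdivrMr //.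
move=> {}ha {}hb {}hc M1 M2 hM1 hM2.
pose n1 := Num.truncn (l * n%:R); pose n2 := (n - n1)%N.
have ln0 : 0 <= l * n%:R by rewrite mulr_ge0.
have n1P : n1%:R <= l * n%:R < n1%:R + 1.
  by have := truncn_itv ln0; rewrite -natr1.
have n1n : (n1 <= n)%N.
  rewrite -(ler_nat R); case/andP: n1P => le1 _; apply: le_trans le1 _.
  by rewrite ler_piMl.
have nE : (n1 + n2 = n)%N by rewrite subnKC.
have n1N : (Nr <= n1)%N.
  rewrite -(ler_nat R); case/andP: n1P; lra.
have n2N : (Ns <= n2)%N.
  by rewrite -(ler_nat R) natrB //; case/andP: n1P; lra.
rewrite -nE (splitr eps).
apply: (ensemble_cat Wch _ _ (hr _ n1N _ _ (size_le_max _ _) (size_le_max _ _))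
  (hs _ n2N _ _ (size_le_max _ _) (size_le_max _ _))).
  by apply: (max_size_mul r10 s10 nE n1P _ hM1); lra.
by apply: (max_size_mul r20 s20 nE n1P _ hM2); lra.
Qed.

Lemma conv_hull_ensemble_achievable (A : set (R * R)) :
  (forall r, A r -> ensemble_achievable r) ->
  forall r, conv_hull A r -> ensemble_achievable r.
Proof.
move=> AE r [k [l [a [l0 [l1 [aA ->]]]]]].
(* Dividing by the total weight gives a statement that survives the removal of one weight, as the
   induction on [k] requires. *)
suff gen : 0 < \sum_i l i -> ensemble_achievable
    ((\sum_i l i * (a i).1) / \sum_i l i, (\sum_i l i * (a i).2) / \sum_i l i).
  by move: gen; rewrite l1 !divr1; apply; exact: ltr01.
have {}aA i : ensemble_achievable (a i) by apply: AE.
elim: k l a l0 aA {l1 AE} => [|k IH] l a l0 aA; first by rewrite big_ord0 ltxx.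
rewrite !big_ord_recl; set S := \sum_i l (lift _ i).
set T1 := \sum_i _; set T2 := \sum_i _ => lS.
have S0 : 0 <= S by apply: sumr_ge0.
have [S0E|SN0] := eqVneq S 0.
  have z i : l (lift ord0 i) = 0.
    move/eqP: S0E; rewrite psumr_eq0 // => /allP/(_ i (mem_index_enum _)).
    by move/eqP.
  have -> : T1 = 0 by apply: big1 => i _; rewrite z mul0r.
  have -> : T2 = 0 by apply: big1 => i _; rewrite z mul0r.
  rewrite S0E !addr0 in lS *; rewrite ![l ord0 * _]mulrC !mulfK ?gt_eqF //.
  by rewrite -surjective_pairing.
have Sp : 0 < S by rewrite lt_def SN0.
have IHS := IH (fun i => l (lift ord0 i)) (fun i => a (lift ord0 i))
  (fun i => l0 _) (fun i => aA _) Sp.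
have := @ensemble_achievable_convex (a ord0) _ (l ord0 / (l ord0 + S)) _ (aA _) IHS.
have lSN0 : l ord0 + S != 0 by rewrite gt_eqF.
have t1 : 1 - l ord0 / (l ord0 + S) = S / (l ord0 + S) by field.
have -> : (l ord0 * (a ord0).1 + T1) / (l ord0 + S)
  = l ord0 / (l ord0 + S) * (a ord0).1 + S / (l ord0 + S) * (T1 / S).
  by field; rewrite SN0 lSN0.
have -> : (l ord0 * (a ord0).2 + T2) / (l ord0 + S)
  = l ord0 / (l ord0 + S) * (a ord0).2 + S / (l ord0 + S) * (T2 / S).
  by field; rewrite SN0 lSN0.
rewrite t1; apply; rewrite divr_ge0 ?(ltW lS) //=.
by rewrite ler_pdivrMr // mul1r lerDl.
Qed.

Lemma msgs_gt0 n (r : R) : (0 < msgs n r)%N.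
Proof. by rewrite /msgs absz_gt0 gt_eqF // ceil_gt0 powR_gt0. Qed.

Lemma msgs_le n (r : R) : (msgs n r)%:R <= 2 `^ (n%:R * r) + 1.
Proof.
rewrite /msgs natr_absz ger0_norm; last by rewrite ltW // ceil_gt0 powR_gt0.
have := ceilB1_lt (2 `^ (n%:R * r)); rewrite intrB => lt; lra.
Qed.

(** [msgs] is a ceiling and may exceed the power by up to 1. The second [eta] of back-off doubles
    the allowed size, which absorbs this; at rate 0 there is exactly one message. *)
Lemma msgs_size_le n (r eta : R) : 0 <= r -> 0 < eta -> 1 <= n%:R * eta ->
  size_le n (r - eta) (msgs n (Num.max 0 (r - 2 * eta))).
Proof.
move=> r0 eta0 big; rewrite /size_le le_max.
have [le0|gt0] := leP (r - 2 * eta) 0.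
  by rewrite /msgs mulr0 powRr0 ceil1 lexx.
apply/orP; right; apply: le_trans (msgs_le _ _) _.
have -> : n%:R * (r - eta) = n%:R * (r - 2 * eta) + n%:R * eta by ring.
rewrite powR2D.
have ge1 : 1 <= 2 `^ (n%:R * (r - 2 * eta)).
  by rewrite -[leLHS](powRr0 2); apply: powR2_mono; rewrite mulr_ge0 // ltW.
have ge2 : 2 <= 2 `^ (n%:R * eta).
  by rewrite -[leLHS]powRr1 //; apply: powR2_mono.
nra.
Qed.

(** One sequence of codes must serve every [eps]: at each [n] a code within [1 / (n + 1)] of the
    least error is chosen. The letters [a0], [b0] give a code at every length, so that the infimum
    is over a nonempty set. *)
Lemma codes_achievable (r : R * R) (a0 : X1) (b0 : X2) : 0 <= r.1 -> 0 <= r.2 ->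
  (forall eps, 0 < eps -> exists N, forall n, (N <= n)%N ->
    exists c : Defs.code X1 X2 n (msgs n r.1) (msgs n r.2), perr W q c <= eps) ->
  achievable W q r.
Proof.
move=> r10 r20 ex; split => //; split => //.
pose E n := range (@perr _ _ _ _ W q n (msgs n r.1) (msgs n r.2)).
have perr0 n M1 M2 (c : Defs.code X1 X2 n M1 M2) : 0 <= perr W q c.
  rewrite mulr_ge0 // ?invr_ge0 //; do 3!apply: sumr_ge0 => ? _.
  by rewrite mulr_ge0 //; [apply: prodr_ge0 => t _; apply: Wch.1|case: ifP].
have Einf n : has_inf (E n).
  split; last by exists 0 => _ [c _ <-].
  by eexists; exists (Code (fun _ _ => a0) (fun _ _ _ => b0)).
have nat0 n : (0 : R) < n.+1%:R^-1 by rewrite invr_gt0 ltr0n.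
have near n : exists c : Defs.code X1 X2 n (msgs n r.1) (msgs n r.2),
    perr W q c < inf (E n) + n.+1%:R^-1.
  by have [_ [c _ <-] lt] := inf_adherent (nat0 n) (Einf n); exists c.
exists (fun n => sval (cid (near n))).
apply/cvgrPdist_le => eps eps0; have eps20 : 0 < eps / 2 by lra.
have [N hN] := ex _ eps20; have [K hK] := exists_nat_ge (eps / 2)^-1.
exists (maxn N K) => // n /=; rewrite geq_max => /andP[Nn Kn].
rewrite sub0r normrN ger0_norm ?perr0 //.
have [c' cle] := hN n Nn; case: (cid _) => c /= clt.
apply: le_trans (ltW clt) _; rewrite [leRHS]splitr; apply: lerD.
  by apply: le_trans cle; apply: (ge_inf (Einf n).2); exists c'.
rewrite invf_ple ?posrE //; apply: le_trans (hK n Kn) _.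
by rewrite ler_nat.
Qed.

Lemma ensemble_achievable_capacity (a0 : X1) (b0 : X2) (r : R * R) :
  ensemble_achievable r -> capacity_region W q r.
Proof.
case=> r10 r20 rA; apply: closure_pair => e e0.
(* Each rate moves by at most [2 * eta = e / 2]; clipping at 0 only brings it closer. *)
pose eta := e / 4; have eta0 : 0 < eta by rewrite /eta; lra.
have dist x : 0 <= x -> `|x - Num.max 0 (x - 2 * eta)| < e.
  move=> x0; rewrite /eta; have [h|h] := leP (x - 2 * (e / 4)) 0.
    by rewrite subr0 ger0_norm //; lra.
  by rewrite ger0_norm; lra.
exists (Num.max 0 (r.1 - 2 * eta), Num.max 0 (r.2 - 2 * eta)).
split => /=; [|exact: dist|exact: dist].
apply: codes_achievable => //=; rewrite ?le_max ?lexx //.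
move=> eps eps0; have [N hN] := rA _ _ eps0 eta0.
have [K hK] := exists_nat_ge eta^-1.
exists (maxn N K) => n; rewrite geq_max => /andP[Nn Kn].
have big : 1 <= n%:R * eta by rewrite -ler_pdivrMr // mul1r hK.
apply: ensemble_perr; rewrite ?msgs_gt0 //.
by apply: hN => //; apply: msgs_size_le.
Qed.

End TimeSharing.

(** * Empirical distributions and type classes *)

Section EmpiricalDistributions.
Variable R : realType.

Definition emp n (Z : finType) (z : {ffun 'I_n -> Z}) (a : Z) : R :=
  n%:R^-1 * \sum_t (z t == a)%:R.

Lemma emp_sum n (Z : finType) (z : {ffun 'I_n -> Z}) (h : Z -> R) :
  \sum_a emp z a * h a = n%:R^-1 * \sum_t h (z t).
Proof.
rewrite mulr_sumr /emp.
under eq_bigr do rewrite -mulrA mulr_suml mulr_sumr.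
rewrite exchange_big /=; apply: eq_bigr => t _.
by rewrite -mulr_sumr sum_delta.
Qed.

Lemma emp_ge0 n (Z : finType) (z : {ffun 'I_n -> Z}) a : 0 <= emp z a.
Proof. by rewrite mulr_ge0 ?invr_ge0 // sumr_ge0. Qed.

Lemma emp_sum1 n (Z : finType) (z : {ffun 'I_n -> Z}) : (0 < n)%N ->
  \sum_a emp z a = 1.
Proof.
move=> n0; under eq_bigr do rewrite -[emp _ _]mulr1.
by rewrite emp_sum sumr_const card_ord mulVf // pnatr_eq0 -lt0n.
Qed.

Lemma emp_gt0 n (Z : finType) (z : {ffun 'I_n -> Z}) t : 0 < emp z (z t).
Proof.
rewrite mulr_gt0 ?invr_gt0 ?ltr0n //; first by case: n z t => // z [].
rewrite (bigD1 t) //= eqxx ltr_pwDl //; exact: sumr_ge0.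
Qed.

Lemma emp_map n (Z T : finType) (g : Z -> T) (z : {ffun 'I_n -> Z}) c :
  emp [ffun t => g (z t)] c = \sum_a emp z a * (g a == c)%:R.
Proof. by rewrite emp_sum; congr (_ * _); apply: eq_bigr => t _; rewrite ffunE. Qed.

Section Chebyshev.
Variables (Z : finType) (P : Z -> R) (n : nat).
Hypotheses (P0 : forall a, 0 <= P a) (P1 : \sum_a P a = 1) (n0 : (0 < n)%N).

(** The deviation is a mean of independent centred variables [u]. The off-diagonal products vanish,
    and each of the [n] diagonal ones is at most 1. *)
Lemma emp_variance a :
  \sum_(z : {ffun 'I_n -> Z}) (\prod_t P (z t)) * (emp z a - P a) ^+ 2 <= n%:R^-1.
Proof.
pose u (b : Z) : R := (b == a)%:R - P a.
have nN0 : n%:R != 0 :> R by rewrite pnatr_eq0 -lt0n.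
have Pu : \sum_b P b * u b = 0.
  under eq_bigr do rewrite mulrBr mulrC.
  rewrite sumrB -mulr_suml P1 mul1r.
  under eq_bigr do rewrite eq_sym.
  by rewrite sum_delta subrr.
have Pa1 : P a <= 1 by rewrite -P1 (bigD1 a) //= lerDl sumr_ge0.
have empE (z : {ffun 'I_n -> Z}) : (emp z a - P a) ^+ 2 =
    n%:R^-2 * \sum_s \sum_t u (z s) * u (z t).
  have -> : emp z a - P a = n%:R^-1 * \sum_t u (z t).
    rewrite /u sumrB sumr_const card_ord mulrBr -/(emp z a); congr (_ - _).
    by rewrite -(mulr_natl (P a)) mulKf.
  rewrite exprMn exprVn; congr (_ * _); rewrite expr2 mulr_suml.
  by apply: eq_bigr => s _; rewrite mulr_sumr.
under eq_bigr do rewrite empE mulrCA.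
rewrite -mulr_sumr ler_pdivrMl ?exprn_gt0 ?ltr0n //.
rewrite expr2 mulfK //.
under eq_bigr do rewrite mulr_sumr.
rewrite exchange_big /=.
have -> : n%:R = \sum_(s < n) 1 :> R by rewrite sumr_const card_ord.
apply: ler_sum => s _; under eq_bigr do rewrite mulr_sumr.
rewrite exchange_big (bigD1 s) //= [X in _ + X]big1 ?addr0; last first.
  move=> t ts; rewrite (prod_marginal2 (fun b c => u b * u c) P1) 1?eq_sym //.
  apply: big1 => b _; under eq_bigr do rewrite mulrCA.
  by rewrite -mulr_sumr Pu !mulr0.
rewrite (prod_marginal1 s (fun b => u b * u b) P1) -P1.
apply: ler_sum => b _; rewrite ler_piMr // /u.
by have := P0 a; case: (b == a) => /=; nra.
Qed.

Definition typical (d : R) (z : {ffun 'I_n -> Z}) : bool :=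
  [forall a, `|emp z a - P a| <= d].

Lemma atypical_prob (d : R) : 0 < d ->
  \sum_(z : {ffun 'I_n -> Z} | ~~ typical d z) \prod_t P (z t)
    <= #|Z|%:R / (d ^+ 2 * n%:R).
Proof.
move=> d0; have d20 : 0 < d ^+ 2 by rewrite exprn_gt0.
(* The indicator of atypicality is at most the sum over letters of the squared deviation divided by
   [d ^+ 2]: Chebyshev and the union bound in one step. *)
apply: (@le_trans _ _ (\sum_a \sum_(z : {ffun 'I_n -> Z})
    (\prod_t P (z t)) * ((emp z a - P a) ^+ 2 / d ^+ 2))); last first.
  rewrite -sumr_const mulr_suml; apply: ler_sum => a _.
  under eq_bigr do rewrite mulrA.
  rewrite -mulr_suml mul1r ler_pdivrMr // invfM mulrAC mulVf ?mul1r ?gt_eqF //.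
  exact: emp_variance.
rewrite exchange_big /= big_mkcond; apply: ler_sum => z _.
have Pz : 0 <= \prod_t P (z t) by apply: prodr_ge0.
have ge0 a : 0 <= (emp z a - P a) ^+ 2 / d ^+ 2.
  by rewrite mulr_ge0 ?invr_ge0 ?sqr_ge0.
rewrite -mulr_sumr; case: ifP => [|_]; last by rewrite mulr_ge0 // sumr_ge0.
rewrite negb_forall => /existsP[a]; rewrite -ltNge => big.
rewrite ler_peMr // (bigD1 a) //= -[leLHS]addr0 lerD ?sumr_ge0 //.
rewrite ler_pdivlMr // mul1r -[leRHS]real_normK ?num_real //.
by rewrite lerXn2r ?nnegrE // ltW.
Qed.

End Chebyshev.

Section TypeClass.
Variables (A B C : finType) (g : B -> C) (U : A -> C -> R) (n : nat).
Hypotheses (U0 : forall a c, 0 <= U a c) (U1 : forall c, \sum_a U a c <= 1).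
Hypothesis n0 : (0 < n)%N.
Variable b : {ffun 'I_n -> B}.

Let gb : {ffun 'I_n -> C} := [ffun t => g (b t)].

(* With [(A, C, B)] distributed as the type of [(a, g(b), b)], this is the ratio
   [P(a | b) / P(a | c)], whose mean logarithm is the conditional mutual
   information [I(A; B | C)]. *)
Definition info_ratio (a : {ffun 'I_n -> A}) (p : A * B) : R :=
  emp (zip2 a b) p * emp gb (g p.2) / (emp (zip2 a gb) (p.1, g p.2) * emp b p.2).

(** Let [V] be the empirical conditional law of [a] given [b], and [G] that of [a] given [g(b)]. On
    the class [info_ratio] is [V / G], so the product of [U] is at most that of [G], which equals
    [E] times that of [V]. Over all sequences the products of [V] sum to 1. *)
Lemma type_class_prob (a0 : {ffun 'I_n -> A}) (D : pred {ffun 'I_n -> A}) :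
  (forall a, D a -> emp (zip2 a b) =1 emp (zip2 a0 b)) ->
  \sum_(a | D a) \prod_t U (a t) (g (b t))
    <= 2 `^ (- (n%:R * \sum_p emp (zip2 a0 b) p * log2 (info_ratio a0 p))).
Proof.
move=> DE; have nN0 : n%:R != 0 :> R by rewrite pnatr_eq0 -lt0n.
set E := _ `^ _.
pose V p := emp (zip2 a0 b) p / emp b p.2.
have Vsum t : \sum_a V (a, b t) = 1.
  rewrite /V /= -mulr_suml; have -> : \sum_a emp (zip2 a0 b) (a, b t) = emp b (b t).
    rewrite -mulr_sumr exchange_big; congr (_ * _); apply: eq_bigr => s _.
    rewrite -[RHS](sum_delta (a0 s) (fun=> (b s == b t)%:R)).
    by apply: eq_bigr => a _; rewrite ffunE xpair_eqE -mulnb natrM.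
  by rewrite divff // gt_eqF // emp_gt0.
have V0 p : 0 <= V p by rewrite mulr_ge0 ?invr_ge0 ?emp_ge0.
have <- : \sum_(a : {ffun 'I_n -> A}) E * \prod_t V (a t, b t) = E.
  rewrite -mulr_sumr (sum_prod_ffun (fun t a => V (a, b t))) big1 ?mulr1 //.
rewrite big_mkcond /=; apply: ler_sum => a _; case: ifP => [Da|_]; last first.
  by rewrite mulr_ge0 ?powR_ge0 ?prodr_ge0.
have abE := DE _ Da.
have gE : emp (zip2 a gb) =1 emp (zip2 a0 gb).
  move=> c; have gz x : zip2 x gb = [ffun t => ((zip2 x b t).1, g (zip2 x b t).2)].
    by apply/ffunP => t; rewrite !ffunE.
  rewrite !gz !(emp_map (fun p => (p.1, g p.2))).
  by apply: eq_bigr => p _; rewrite abE.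
have pos1 t : 0 < emp (zip2 a0 b) (a t, b t).
  by have := emp_gt0 (zip2 a b) t; rewrite abE ffunE.
have pos2 t : 0 < emp (zip2 a0 gb) (a t, g (b t)).
  by have := emp_gt0 (zip2 a gb) t; rewrite gE !ffunE.
have pos3 t : 0 < emp gb (g (b t)) by have := emp_gt0 gb t; rewrite ffunE.
have pos4 t : 0 < emp b (b t) by apply: emp_gt0.
have posr t : 0 < info_ratio a0 (a t, b t).
  by rewrite /info_ratio divr_gt0 //= mulr_gt0.
have EE : E = \prod_t (info_ratio a0 (a t, b t))^-1.
  rewrite /E; have -> : n%:R * \sum_p emp (zip2 a0 b) p * log2 (info_ratio a0 p)
      = \sum_t log2 (info_ratio a0 (a t, b t)).
    under eq_bigr do rewrite -abE.
    by rewrite emp_sum mulVKf //; apply: eq_bigr => t _; rewrite ffunE.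
  rewrite powRN prodfV /powR pnatr_eq0 /= /log2 -mulr_suml divfK; last first.
    by rewrite gt_eqF // ln_gt0 // ltr1n.
  congr (_^-1); rewrite expR_sum; apply: eq_bigr => t _.
  by rewrite lnK // posrE.
pose G t := emp (zip2 a0 gb) (a t, g (b t)) / emp gb (g (b t)).
have Gpos t : 0 < G t by rewrite divr_gt0.
have -> : E * \prod_t V (a t, b t) = \prod_t G t.
  rewrite EE -big_split; apply: eq_bigr => t _ /=.
  by rewrite /G /V /info_ratio /=; field; rewrite !gt_eqF.
rewrite -[leRHS]mul1r -ler_pdivrMr ?prodr_gt0 // -prodf_div.
(* AM-GM plays the role of Gibbs' inequality. *)
have := @leif_AGM R 'I_n predT (fun t => U (a t) (g (b t)) / G t).
rewrite /= card_ord => /(_ _)[|le _].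
  by move=> t _; rewrite mulr_ge0 ?invr_ge0 // ltW.
apply: le_trans le _; rewrite exprn_ile1 // ?mulr_ge0 ?invr_ge0 //.
  by apply: sumr_ge0 => t _; rewrite mulr_ge0 ?invr_ge0 // ltW.
pose h (p : A * C) := U p.1 p.2 / (emp (zip2 a gb) p / emp gb p.2).
have -> : (\sum_t U (a t) (g (b t)) / G t) / n%:R
    = \sum_p emp (zip2 a gb) p * h p.
  rewrite emp_sum mulrC; congr (_ * _); apply: eq_bigr => t _.
  by rewrite /h /G gE !ffunE.
rewrite -(emp_sum1 gb n0) -(pair_bigA _ (fun x c => emp (zip2 a gb) (x, c) * h (x, c))).
rewrite exchange_big /=; apply: ler_sum => c _.
(* The empirical mass of a cell cancels; cells of mass zero contribute nothing on the left, whence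
   an inequality. *)
apply: (@le_trans _ _ (\sum_x emp gb c * U x c)).
  apply: ler_sum => x _; rewrite /h /=.
  have [->|nz] := eqVneq (emp (zip2 a gb) (x, c)) 0.
    by rewrite mul0r mulr_ge0 ?emp_ge0.
  have [->|nz'] := eqVneq (emp gb c) 0; first by rewrite invr0 !mulr0 invr0 !mulr0 mul0r.
  by rewrite le_eqVlt; apply/orP; left; apply/eqP; field; rewrite nz nz'.
by rewrite -mulr_sumr ler_piMr ?emp_ge0.
Qed.

End TypeClass.
End EmpiricalDistributions.
Arguments emp {R n Z} z a.

Section JointTypes.
Variables (R : realType) (X1 X2 Y : finType) (n : nat).
Hypothesis n0 : (0 < n)%N.

Definition joint_type (x1 : {ffun 'I_n -> X1}) (x2 : {ffun 'I_n -> X2})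
    (y : {ffun 'I_n -> Y}) : dist3 R X1 X2 Y :=
  fun a b c => emp (zip2 (zip2 x1 x2) y) (a, b, c).

Lemma sum_delta_andr (T : finType) (A : bool) (c : T) :
  \sum_d (A && (c == d))%:R = A%:R :> R.
Proof.
under eq_bigr do rewrite andbC -mulnb natrM.
by rewrite (sum_delta c (fun=> A%:R)).
Qed.

Lemma sum_delta_mid (T : finType) (A B : bool) (c : T) :
  \sum_d (A && (c == d) && B)%:R = (A && B)%:R :> R.
Proof. by under eq_bigr do rewrite andbAC; apply: sum_delta_andr. Qed.

Lemma m12_type x1 x2 y a b : m12 (joint_type x1 x2 y) a b = emp (zip2 x1 x2) (a, b).
Proof.
rewrite /m12 /joint_type /emp -mulr_sumr exchange_big; congr (_ * _).
apply: eq_bigr => t _ /=; rewrite -[RHS](sum_delta_andr _ (y t)).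
by apply: eq_bigr => c _; rewrite ffunE.
Qed.

Lemma m13_type x1 x2 y a c : m13 (joint_type x1 x2 y) a c = emp (zip2 x1 y) (a, c).
Proof.
rewrite /m13 /joint_type /emp -mulr_sumr exchange_big; congr (_ * _).
apply: eq_bigr => t _ /=; rewrite [zip2 x1 y t]ffunE xpair_eqE.
rewrite -(sum_delta_mid _ _ (x2 t)).
by apply: eq_bigr => b _; rewrite !ffunE.
Qed.

Lemma m3_type x1 x2 y c : m3 (joint_type x1 x2 y) c = emp y c.
Proof.
rewrite /m3; transitivity (\sum_a emp (zip2 x1 y) (a, c) : R).
  by apply: eq_bigr => a _; rewrite -(m13_type x1 x2).
rewrite /emp -mulr_sumr exchange_big; congr (_ * _).
apply: eq_bigr => t _ /=; rewrite -[RHS](sum_delta_andr _ (x1 t)).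
by apply: eq_bigr => a _; rewrite ffunE xpair_eqE andbC.
Qed.

Lemma m1_type x1 x2 y a : m1 (joint_type x1 x2 y) a = emp x1 a.
Proof.
rewrite /m1; transitivity (\sum_b emp (zip2 x1 x2) (a, b) : R).
  by apply: eq_bigr => b _; rewrite -(m12_type x1 x2 y).
rewrite /emp -mulr_sumr exchange_big; congr (_ * _).
apply: eq_bigr => t _ /=; rewrite -[RHS](sum_delta_andr _ (x2 t)).
by apply: eq_bigr => b _; rewrite ffunE xpair_eqE.
Qed.

Lemma sum_dist3 (F : X1 * X2 * Y -> R) :
  \sum_p F p = \sum_a \sum_b \sum_c F (a, b, c).
Proof. by rewrite !pair_bigA; apply: eq_bigr => -[[a b] c]. Qed.

Lemma joint_type_dist x1 x2 y : is_dist3 (joint_type x1 x2 y).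
Proof.
split; first by move=> *; apply: emp_ge0.
by rewrite -(emp_sum1 R (zip2 (zip2 x1 x2) y) n0) sum_dist3.
Qed.

Lemma Eq_type q x1 x2 y :
  Eq q (joint_type x1 x2 y) = n%:R^-1 * \sum_t q (x1 t) (x2 t) (y t).
Proof.
rewrite /Eq /joint_type -(sum_dist3 (fun p => emp _ p * q p.1.1 p.1.2 p.2)).
by rewrite emp_sum; congr (_ * _); apply: eq_bigr => t _; rewrite !ffunE.
Qed.

Lemma if0_mul (x z : R) : (if x == 0 then 0 else x * z) = x * z.
Proof. by case: eqP => // ->; rewrite mul0r. Qed.

(** Conditioning on a [unit] component is no conditioning. This makes the unconditional informations
    instances of [info_ratio]. *)
Lemma emp_tt (w : {ffun 'I_n -> unit}) : emp w tt = 1 :> R.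
Proof.
rewrite /emp (eq_bigr (fun=> 1)) => [|t _]; last by case: (w t).
by rewrite sumr_const card_ord mulVf // pnatr_eq0 -lt0n.
Qed.

Lemma emp_zip_tt (A : finType) (x : {ffun 'I_n -> A}) (w : {ffun 'I_n -> unit}) a :
  emp (zip2 x w) (a, tt) = emp x a :> R.
Proof.
congr (_ * _); apply: eq_bigr => t _.
by rewrite ffunE xpair_eqE; case: (w t); rewrite andbT.
Qed.

Section ClassBounds.
Variables (x1' : {ffun 'I_n -> X1}) (x2' : {ffun 'I_n -> X2}) (y : {ffun 'I_n -> Y}).

Lemma class_prob_X1X2 (PX : X1 -> X2 -> R) (D : {ffun 'I_n -> X1} -> pred {ffun 'I_n -> X2}) :
  is_dist2 PX ->
  (forall x1 x2, D x1 x2 ->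
     emp (zip2 (zip2 x1 x2) y) =1 emp (R := R) (zip2 (zip2 x1' x2') y)) ->
  \sum_x1 \sum_(x2 | D x1 x2) \prod_t PX (x1 t) (x2 t)
    <= 2 `^ (- (n%:R * MI_X1X2Y (joint_type x1' x2' y))).
Proof.
move=> [PX0 PX1] DE.
have -> : MI_X1X2Y (joint_type x1' x2' y) = \sum_p emp (zip2 (zip2 x1' x2') y) p *
   log2 (info_ratio R (fun=> tt) y (zip2 x1' x2') p).
  rewrite sum_dist3; do 3!apply: eq_bigr => ? _.
  rewrite if0_mul; congr (_ * log2 _).
  by rewrite m12_type m3_type /info_ratio emp_tt emp_zip_tt mulr1.
pose D' (z : {ffun 'I_n -> X1 * X2}) :=
  D [ffun t => (z t).1] [ffun t => (z t).2].
have zK (x1 : {ffun 'I_n -> X1}) (x2 : {ffun 'I_n -> X2}) :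
    D' (zip2 x1 x2) = D x1 x2.
  by rewrite /D'; congr (D _ _); apply/ffunP => t; rewrite !ffunE.
apply: (le_trans _ (type_class_prob (fun=> tt) (U := fun p _ => PX p.1 p.2) (b := y)
  (a0 := zip2 x1' x2') (D := D') _ _ n0 _)).
- rewrite [leRHS]big_mkcond sum_zip2 le_eqVlt; apply/orP; left; apply/eqP.
  apply: eq_bigr => x1 _; rewrite big_mkcond; apply: eq_bigr => x2 _.
  rewrite zK; case: ifP => // _; apply: eq_bigr => t _; by rewrite ffunE.
- by move=> *.
- by move=> _; rewrite -(pair_bigA _ PX) PX1.
- move=> z Dz; have -> : z = zip2 [ffun t => (z t).1] [ffun t => (z t).2].
    by apply/ffunP => t; rewrite !ffunE -surjective_pairing.
  exact: DE.
Qed.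

Lemma class_prob_X1 (P1 : X1 -> R) (D : pred {ffun 'I_n -> X1}) :
  (forall a, 0 <= P1 a) -> \sum_a P1 a <= 1 ->
  (forall x1, D x1 -> emp (zip2 x1 y) =1 emp (R := R) (zip2 x1' y)) ->
  \sum_(x1 | D x1) \prod_t P1 (x1 t)
    <= 2 `^ (- (n%:R * MI_X1Y (joint_type x1' x2' y))).
Proof.
move=> P10 P11 DE.
have -> : MI_X1Y (joint_type x1' x2' y) = \sum_p emp (zip2 x1' y) p *
   log2 (info_ratio R (fun=> tt) y x1' p).
  rewrite /MI_X1Y pair_bigA; apply: eq_bigr => -[a c] _ /=.
  rewrite if0_mul m13_type; congr (_ * log2 _).
  by rewrite m1_type m3_type /info_ratio emp_tt emp_zip_tt mulr1.
exact: (type_class_prob (fun=> tt) (U := fun a _ => P1 a) (fun a _ => P10 a) (fun _ => P11) n0 DE).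
Qed.

(** The known sequence is the pair of [x1'] and [y], with [g = fst]. The law [P21] sees only the
    first component, so the exponent is conditional on [X1]. *)
Lemma class_prob_X2 (P21 : X2 -> X1 -> R) (D : pred {ffun 'I_n -> X2}) :
  (forall b a, 0 <= P21 b a) -> (forall a, \sum_b P21 b a <= 1) ->
  (forall x2, D x2 ->
     emp (zip2 (zip2 x1' x2) y) =1 emp (R := R) (zip2 (zip2 x1' x2') y)) ->
  \sum_(x2 | D x2) \prod_t P21 (x2 t) (x1' t)
    <= 2 `^ (- (n%:R * MI_X2Y_given_X1 (joint_type x1' x2' y))).
Proof.
move=> P0 P1 DE.
have swap (x2 : {ffun 'I_n -> X2}) a b c : emp (R := R) (zip2 x2 (zip2 x1' y)) (b, (a, c))
    = emp (zip2 (zip2 x1' x2) y) (a, b, c).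
  congr (_ * _); apply: eq_bigr => t _; rewrite !ffunE !xpair_eqE.
  by rewrite andbA [(x2 t == b) && _]andbC.
have -> : MI_X2Y_given_X1 (joint_type x1' x2' y) =
   \sum_p emp (zip2 x2' (zip2 x1' y)) p * log2 (info_ratio R fst (zip2 x1' y) x2' p).
  rewrite /MI_X2Y_given_X1 exchange_big /=.
  under eq_bigr do rewrite pair_bigA.
  rewrite pair_bigA; apply: eq_bigr => -[b [a c]] _ /=.
  rewrite if0_mul swap; congr (_ * log2 _).
  rewrite m1_type m12_type m13_type /info_ratio swap /=.
  have -> : [ffun t => (zip2 x1' y t).1] = x1'.
    by apply/ffunP => t; rewrite !ffunE.
  congr (_ / (_ * _)); congr (_ * _); apply: eq_bigr => t _.
  by rewrite !ffunE !xpair_eqE andbC.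
apply: (le_trans _ (type_class_prob fst (b := zip2 x1' y) (a0 := x2') (D := D) P0 P1 n0 _)).
  by apply: ler_sum => x2 _; under [leRHS]eq_bigr do rewrite ffunE.
by move=> x2 Dx2 [b [a c]]; rewrite !swap DE.
Qed.

End ClassBounds.
End JointTypes.

(** * Continuity and compactness *)

Section Continuity.
Variable R : realType.

Definition xlnx (x : R) : R := x * ln x.

(** With [s] the square root, [- x ln x = 2 s^2 ln (1/s)], and [ln u < u] at [u = 1/s] removes one
    factor [s]. *)
Lemma xlnx_sqrt (x : R) : 0 <= x <= 1 -> `|xlnx x| <= 2 * Num.sqrt x.
Proof.
move=> /andP[x0 x1]; have [->|xN0] := eqVneq x 0.
  by rewrite /xlnx mul0r normr0 sqrtr0 mulr0.
have xp : 0 < x by rewrite lt_def xN0.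
set s := Num.sqrt x; have sp : 0 < s by rewrite sqrtr_gt0.
have xE : x = s ^+ 2 by rewrite sqr_sqrtr.
have s1 : 0 < s^-1 by rewrite invr_gt0.
have lns : - ln s <= s^-1 by rewrite -lnV ?posrE //; apply/ltW/ln_sublinear.
rewrite ler0_norm; last by rewrite /xlnx mulr_ge0_le0 // ln_le0.
have lnx : ln x = 2 * ln s by rewrite xE lnXn // mulr_natl.
have -> : - xlnx x = 2 * s ^+ 2 * (- ln s) by rewrite /xlnx lnx -xE; ring.
have -> : 2 * s = 2 * s ^+ 2 * s^-1 by field; rewrite gt_eqF.
by apply: ler_wpM2l => //; rewrite mulr_ge0 // sqr_ge0.
Qed.

(** [ln] has default value 0 on nonpositive reals. Hence [xlnx] is continuous on the whole line, and
    the informations on the whole vector space. *)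
Lemma xlnx_le0 (x : R) : x <= 0 -> xlnx x = 0.
Proof. by move=> x0; rewrite /xlnx ln0 ?mulr0. Qed.

Lemma continuous_xlnx : continuous xlnx.
Proof.
move=> x; have [x0|x0|->] := ltgtP x 0.
- apply/cvgrPdist_le => e e0; near=> y.
  have y0 : y < 0 by near: y; apply: lt_nbhsl.
  by rewrite (xlnx_le0 (ltW x0)) (xlnx_le0 (ltW y0)) subr0 normr0 ltW.
- apply: continuousM; first exact: cvg_id.
  exact: continuous_ln.
have bound : \forall y \near (0 : R), `|xlnx y| <= 2 * Num.sqrt y.
  near=> y; have [y0|y0] := leP y 0.
    by rewrite xlnx_le0 // normr0 mulr_ge0 // sqrtr_ge0.
  by apply: xlnx_sqrt; rewrite (ltW y0) ltW //; near: y; apply: lt_nbhsl.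
rewrite /continuous_at xlnx_le0 //; apply/norm_cvg0P.
apply: (squeeze_cvgr (f := fun=> 0) (h := fun y => 2 * Num.sqrt y)).
- by near=> y; rewrite normr_ge0 /=; near: y.
- exact: cvg_cst.
have : 2 * Num.sqrt y @[y --> (0 : R)] --> 2 * Num.sqrt (0 : R).
  by apply: cvgM; [exact: cvg_cst|exact: sqrt_continuous].
by rewrite sqrtr0 mulr0.
Unshelve. all: by end_near. Qed.

Lemma continuous_sum (T : topologicalType) (I : finType) (F : I -> T -> R) :
  (forall i, continuous (F i)) -> continuous (fun v => \sum_i F i v).
Proof.
move=> Fc; apply: continuous_big => [|i _]; last exact: Fc.
by move=> p; apply: cvgD; [exact: cvg_fst|exact: cvg_snd].
Qed.

Lemma cube_positive_min (N : nat) (h : 'rV[R]_N -> R) : continuous h ->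
  (forall v : 'rV[R]_N, (forall i, 0 <= v ord0 i <= 1) -> 0 < h v) ->
  exists2 d, 0 < d & forall v : 'rV[R]_N, (forall i, 0 <= v ord0 i <= 1) -> d <= h v.
Proof.
move=> hc hpos.
pose K := [set v : 'rV[R]_N | forall i, `[0, 1]%classic (v ord0 i)].
have KE v : K v <-> (forall i, 0 <= v ord0 i <= 1).
  by split=> H i; have := H i; rewrite /= in_itv.
have [||c cK cmin] := @compact_EVT_min _ R h K _ (rV_compact (fun=> @segment_compact R 0 1)).
- by exists 0; apply/KE => i; rewrite mxE lexx ler01.
- exact: continuous_subspaceT.
exists (h c); first by apply: hpos; apply/KE; rewrite inE in cK.
by move=> v vK; apply: cmin; rewrite inE; apply/KE.
Qed.

Section Joint.
Variables X1 X2 Y : finType.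
Let N := #|{: X1 * X2 * Y}|.

(** Joint laws are coded as row vectors in order to use the compactness of the cube of row
    vectors. *)
Definition of_row (v : 'rV[R]_N) : dist3 R X1 X2 Y :=
  fun a b c => v ord0 (enum_rank (a, b, c)).

Definition to_row (f : dist3 R X1 X2 Y) : 'rV[R]_N :=
  \row_i f (enum_val i).1.1 (enum_val i).1.2 (enum_val i).2.

Lemma to_rowK f : of_row (to_row f) = f.
Proof.
by do 3!apply: funext => ?; rewrite /of_row mxE enum_rankK.
Qed.

Definition cts (F : dist3 R X1 X2 Y -> R) := continuous (fun v => F (of_row v)).

Lemma cts_coord a b c : cts (fun f => f a b c).
Proof. exact: coord_continuous. Qed.

Lemma cts_sum (I : finType) (F : I -> dist3 R X1 X2 Y -> R) :
  (forall i, cts (F i)) -> cts (fun f => \sum_i F i f).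
Proof. by move=> Fc; apply: continuous_sum. Qed.

Lemma cts_comp (g : R -> R) F : continuous g -> cts F -> cts (fun f => g (F f)).
Proof. by move=> gc Fc v; apply: continuous_comp; [exact: Fc|exact: gc]. Qed.

Lemma cts_cst k : cts (fun=> k).
Proof. exact: cst_continuous. Qed.

Lemma cts_add F G : cts F -> cts G -> cts (fun f => F f + G f).
Proof. by move=> Fc Gc v; exact: (cvgD (Fc v) (Gc v)). Qed.

Lemma cts_sub F G : cts F -> cts G -> cts (fun f => F f - G f).
Proof. by move=> Fc Gc v; exact: (cvgB (Fc v) (Gc v)). Qed.

Lemma cts_mul F G : cts F -> cts G -> cts (fun f => F f * G f).
Proof. by move=> Fc Gc v; exact: (cvgM (Fc v) (Gc v)). Qed.

Lemma cts_norm F : cts F -> cts (fun f => `|F f|).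
Proof. by apply: cts_comp; exact: norm_continuous. Qed.

Lemma cts_max F G : cts F -> cts G -> cts (fun f => Num.max (F f) (G f)).
Proof. by move=> Fc Gc v; exact: (continuous_max (Fc v) (Gc v)). Qed.

Lemma cts_m12 a b : cts (fun f => m12 f a b).
Proof. by apply: cts_sum => c; exact: cts_coord. Qed.

Lemma cts_m13 a c : cts (fun f => m13 f a c).
Proof. by apply: cts_sum => b; exact: cts_coord. Qed.

Lemma cts_m1 a : cts (fun f => m1 f a).
Proof. by do 2!apply: cts_sum => ?; exact: cts_coord. Qed.

Lemma cts_m3 c : cts (fun f => m3 f c).
Proof. by do 2!apply: cts_sum => ?; exact: cts_coord. Qed.

Lemma cts_Eq q : cts (Eq q).
Proof.
do 3!apply: cts_sum => ?; apply: cts_mul; [exact: cts_coord|exact: cts_cst].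
Qed.

(* The three informations written with [x * ln x], which is continuous at 0. *)
Definition cMI_X2Y_given_X1 (f : dist3 R X1 X2 Y) : R :=
  (\sum_a \sum_b \sum_c xlnx (f a b c) + \sum_a xlnx (m1 f a)
   - (\sum_a \sum_b xlnx (m12 f a b)) - \sum_a \sum_c xlnx (m13 f a c)) / ln 2.

Definition cMI_X1Y (f : dist3 R X1 X2 Y) : R :=
  (\sum_a \sum_c xlnx (m13 f a c) - (\sum_a xlnx (m1 f a))
   - \sum_c xlnx (m3 f c)) / ln 2.

Definition cMI_X1X2Y (f : dist3 R X1 X2 Y) : R :=
  (\sum_a \sum_b \sum_c xlnx (f a b c) - (\sum_a \sum_b xlnx (m12 f a b))
   - \sum_c xlnx (m3 f c)) / ln 2.

Lemma cts_cMI_X2Y_given_X1 : cts cMI_X2Y_given_X1.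
Proof.
apply: cts_mul; last exact: cts_cst.
apply: cts_sub; first apply: cts_sub; first apply: cts_add.
all: repeat (apply: cts_sum => ?); apply: cts_comp; try exact: continuous_xlnx.
- exact: cts_coord.
- exact: cts_m1.
- exact: cts_m12.
- exact: cts_m13.
Qed.

Lemma cts_cMI_X1Y : cts cMI_X1Y.
Proof.
apply: cts_mul; last exact: cts_cst.
apply: cts_sub; first apply: cts_sub.
- by do 2!apply: cts_sum => ?; apply: cts_comp; [exact: continuous_xlnx|exact: cts_m13].
- by apply: cts_sum => ?; apply: cts_comp; [exact: continuous_xlnx|exact: cts_m1].
- by apply: cts_sum => ?; apply: cts_comp; [exact: continuous_xlnx|exact: cts_m3].
Qed.

Lemma cts_cMI_X1X2Y : cts cMI_X1X2Y.
Proof.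
apply: cts_mul; last exact: cts_cst.
apply: cts_sub; first apply: cts_sub.
- by do 3!apply: cts_sum => ?; apply: cts_comp; [exact: continuous_xlnx|exact: cts_coord].
- by do 2!apply: cts_sum => ?; apply: cts_comp; [exact: continuous_xlnx|exact: cts_m12].
- by apply: cts_sum => ?; apply: cts_comp; [exact: continuous_xlnx|exact: cts_m3].
Qed.

Section Values.
Variable f : dist3 R X1 X2 Y.
Hypothesis f0 : forall a b c, 0 <= f a b c.

Lemma m12_ge a b c : f a b c <= m12 f a b.
Proof. by rewrite /m12 (bigD1 c) //= lerDl sumr_ge0. Qed.

Lemma m13_ge a b c : f a b c <= m13 f a c.
Proof. by rewrite /m13 (bigD1 b) //= lerDl sumr_ge0. Qed.

Lemma m13_ge0 a c : 0 <= m13 f a c.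
Proof. exact: sumr_ge0. Qed.

Lemma m1_sum13 a : m1 f a = \sum_c m13 f a c.
Proof. by rewrite /m1 exchange_big. Qed.

Lemma m13_m1 a c : m13 f a c <= m1 f a.
Proof. by rewrite m1_sum13 (bigD1 c) //= lerDl sumr_ge0 // => ? _; exact: m13_ge0. Qed.

Lemma m13_m3 a c : m13 f a c <= m3 f c.
Proof. by rewrite /m3 (bigD1 a) //= lerDl sumr_ge0 // => ? _; exact: m13_ge0. Qed.

Lemma m3_sum c : m3 f c = \sum_a \sum_b f a b c. Proof. by []. Qed.

(** Marginal entropies are spread over the joint cells. In a cell of positive mass the marginals are
    positive and the logarithm splits; in a null cell both sides vanish. Nonnegativity is all that
    is asked, since points of the cube need not be normalised. *)
Lemma MI_X1YE : MI_X1Y f = cMI_X1Y f.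
Proof.
rewrite /cMI_X1Y.
have -> : \sum_a xlnx (m1 f a) = \sum_a \sum_c m13 f a c * ln (m1 f a).
  by apply: eq_bigr => a _; rewrite -mulr_suml -m1_sum13.
have -> : \sum_c xlnx (m3 f c) = \sum_a \sum_c m13 f a c * ln (m3 f c).
  by rewrite exchange_big; apply: eq_bigr => c _; rewrite /= -mulr_suml.
rewrite -!sumrB mulr_suml; apply: eq_bigr => a _.
rewrite -!sumrB mulr_suml; apply: eq_bigr => c _.
rewrite if0_mul /xlnx; have [->|nz] := eqVneq (m13 f a c) 0.
  by rewrite !mul0r !subr0 mul0r.
have p13 : 0 < m13 f a c by rewrite lt_def nz m13_ge0.
have p1 := lt_le_trans p13 (m13_m1 a c); have p3 := lt_le_trans p13 (m13_m3 a c).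
rewrite /log2 ln_div ?posrE ?mulr_gt0 // lnM ?posrE //; ring.
Qed.

Lemma MI_X1X2YE : MI_X1X2Y f = cMI_X1X2Y f.
Proof.
rewrite /cMI_X1X2Y.
have -> : \sum_a \sum_b xlnx (m12 f a b)
    = \sum_a \sum_b \sum_c f a b c * ln (m12 f a b).
  by apply: eq_bigr => a _; apply: eq_bigr => b _; rewrite -mulr_suml.
have -> : \sum_c xlnx (m3 f c) = \sum_a \sum_b \sum_c f a b c * ln (m3 f c).
  under [RHS]eq_bigr do rewrite exchange_big.
  rewrite exchange_big; apply: eq_bigr => c _; rewrite /xlnx m3_sum mulr_suml.
  by apply: eq_bigr => a _; rewrite mulr_suml.
rewrite -!sumrB mulr_suml; apply: eq_bigr => a _.
rewrite -!sumrB mulr_suml; apply: eq_bigr => b _.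
rewrite -!sumrB mulr_suml; apply: eq_bigr => c _.
rewrite if0_mul /xlnx; have [->|nz] := eqVneq (f a b c) 0.
  by rewrite !mul0r !subr0 mul0r.
have p : 0 < f a b c by rewrite lt_def nz f0.
have p12 := lt_le_trans p (m12_ge a b c).
have p3 := lt_le_trans p (le_trans (m13_ge a b c) (m13_m3 a c)).
rewrite /log2 ln_div ?posrE ?mulr_gt0 // lnM ?posrE //; ring.
Qed.

Lemma MI_X2Y_given_X1E : MI_X2Y_given_X1 f = cMI_X2Y_given_X1 f.
Proof.
rewrite /cMI_X2Y_given_X1.
have -> : \sum_a xlnx (m1 f a) = \sum_a \sum_b \sum_c f a b c * ln (m1 f a).
  apply: eq_bigr => a _; rewrite /xlnx /m1 mulr_suml.
  by apply: eq_bigr => b _; rewrite mulr_suml.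
have -> : \sum_a \sum_b xlnx (m12 f a b)
    = \sum_a \sum_b \sum_c f a b c * ln (m12 f a b).
  by apply: eq_bigr => a _; apply: eq_bigr => b _; rewrite -mulr_suml.
have -> : \sum_a \sum_c xlnx (m13 f a c)
    = \sum_a \sum_b \sum_c f a b c * ln (m13 f a c).
  apply: eq_bigr => a _; rewrite exchange_big; apply: eq_bigr => c _.
  by rewrite -mulr_suml.
rewrite -!big_split -!sumrB mulr_suml; apply: eq_bigr => a _.
rewrite -!big_split -!sumrB mulr_suml; apply: eq_bigr => b _.
rewrite -!big_split -!sumrB mulr_suml; apply: eq_bigr => c _ /=.
rewrite if0_mul /xlnx; have [->|nz] := eqVneq (f a b c) 0.
  by rewrite !mul0r addr0 !subr0 mul0r.
have p : 0 < f a b c by rewrite lt_def nz f0.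
have p12 := lt_le_trans p (m12_ge a b c).
have p13 := lt_le_trans p (m13_ge a b c).
have p1 := lt_le_trans p13 (m13_m1 a c).
rewrite /log2 ln_div ?posrE ?mulr_gt0 // !lnM ?posrE //; ring.
Qed.

End Values.

(** The maximum of [F] and [H] is positive on the cube, hence at least some [d > 0] there. Where [F]
    is below [d], the maximum is attained by [H]. *)
Lemma compactness_gap (F H : dist3 R X1 X2 Y -> R) : cts F -> cts H ->
  (forall f, 0 <= F f) ->
  (forall f, (forall a b c, 0 <= f a b c) -> F f = 0 -> 0 < H f) ->
  exists2 d, 0 < d & forall f, is_dist3 f -> F f < d -> d <= H f.
Proof.
move=> Fc Hc F0 FH.
have [v vK|d d0 dmin] := cube_positive_min (cts_max Fc Hc).
  rewrite lt_max; have := F0 (of_row v); rewrite le_eqVlt => /orP[/eqP/esym z|->//].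
  apply/orP; right; apply: FH => // a b c.
  by case/andP: (vK (enum_rank (a, b, c))).
exists d => // f [f0 f1] Fd.
have := dmin (to_row f); rewrite to_rowK le_max [d <= F f]leNgt Fd /=; apply.
move=> i; rewrite mxE f0 /= -f1.
case: (enum_val i) => -[a b] c /=.
have le12 : m12 f a b <= \sum_b m12 f a b.
  by rewrite (bigD1 b) //= lerDl sumr_ge0 // => ? _; exact: sumr_ge0.
apply: le_trans (m12_ge f0 a b c) (le_trans le12 _).
rewrite [leRHS](bigD1 a) //= lerDl sumr_ge0 // => ? _.
by do 2!apply: sumr_ge0 => ? _.
Qed.

End Joint.
End Continuity.

(** * Superposition coding *)

Section TypeCounting.
Variables (R : realType) (n : nat) (Z : finType).

Definition same_type (z w : {ffun 'I_n -> Z}) : bool :=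
  [forall a, emp z a == emp w a :> R].

(** Letter counts, unlike real frequencies, range over a finite type of known size. A count never
    exceeds [n], so [inord] truncates nothing. *)
Definition type_code (z : {ffun 'I_n -> Z}) : {ffun Z -> 'I_n.+1} :=
  [ffun a => inord (\sum_t (z t == a))].

Lemma type_code_inj z w : type_code z = type_code w -> same_type z w.
Proof.
move=> zw; apply/forallP => a; apply/eqP; rewrite /emp -!natr_sum.
have le (v : {ffun 'I_n -> Z}) : (\sum_t (v t == a) < n.+1)%N.
  rewrite ltnS -[leqRHS]card_ord -sum1_card; apply: leq_sum => t _.
  exact: leq_b1.
have /(congr1 (fun g : {ffun _ -> 'I_n.+1} => val (g a))) := zw.
by rewrite /= !ffunE !inordK // => ->.
Qed.

(** The event is split by the type of a witness [j]. A nonempty class is bounded through any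
    representative of it. [J] indexes the satellites when [k] is a whole cloud. *)
Lemma type_union (T J : finType) (w : T -> R) (E : T -> J -> bool)
    (z : T -> J -> {ffun 'I_n -> Z}) (b : R) :
  (forall k, 0 <= w k) -> 0 <= b ->
  (forall k0 j0, E k0 j0 ->
     \sum_(k | [exists j, E k j && same_type (z k j) (z k0 j0)]) w k <= b) ->
  \sum_(k | [exists j, E k j]) w k <= (n.+1 ^ #|Z|)%:R * b.
Proof.
move=> w0 b0 classb.
apply: (@le_trans _ _ (\sum_(tau : {ffun Z -> 'I_n.+1})
    \sum_(k | [exists j, E k j && (type_code (z k j) == tau)]) w k)).
  under [leRHS]eq_bigr do rewrite big_mkcond.
  rewrite exchange_big /= big_mkcond; apply: ler_sum => k _.
  case: ifP => [/existsP[j Ej]|_]; last by apply: sumr_ge0 => tau _; case: ifP.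
  rewrite (bigD1 (type_code (z k j))) //= ifT; last first.
    by apply/existsP; exists j; rewrite Ej eqxx.
  by rewrite lerDl sumr_ge0 // => tau _; case: ifP.
have -> : (n.+1 ^ #|Z|)%:R * b = \sum_(tau : {ffun Z -> 'I_n.+1}) b.
  by rewrite sumr_const card_ffun card_ord mulr_natl.
apply: ler_sum => tau _.
have [[k0 [j0 /andP[E0 /eqP tau0]]]|none] :=
    pselect (exists k0 j0, E k0 j0 && (type_code (z k0 j0) == tau)).
  apply: le_trans (classb _ _ E0); rewrite big_mkcond [leRHS]big_mkcond.
  apply: ler_sum => k _; case: ifP => [/existsP[j /andP[Ej /eqP tauj]]|_].
    rewrite ifT //; apply/existsP; exists j; rewrite Ej /=.
    by apply: type_code_inj; rewrite tauj.
  by case: ifP.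
rewrite big_pred0 // => k; apply/negbTE/negP => /existsP[j Ej].
by apply: none; exists k, j.
Qed.

End TypeCounting.

(** * Input laws restricted to typical pairs *)

Section RestrictedLaw.
Variables (R : realType) (X1 X2 : finType) (PX : X1 -> X2 -> R).
Hypothesis PXd : is_dist2 PX.

Definition PX1 a : R := \sum_b PX a b.
(* Junk value: [PX21 b a = 0] whenever [PX1 a = 0]. *)
Definition PX21 b a : R := PX a b / PX1 a.

Lemma PX1_ge0 a : 0 <= PX1 a.
Proof. by apply: sumr_ge0 => b _; apply: PXd.1. Qed.

Lemma PX1_sum : \sum_a PX1 a = 1.
Proof. exact: PXd.2. Qed.

Lemma PX21_ge0 b a : 0 <= PX21 b a.
Proof. by rewrite mulr_ge0 ?invr_ge0 ?PX1_ge0 //; apply: PXd.1. Qed.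

Lemma PX21_sum_le1 a : \sum_b PX21 b a <= 1.
Proof.
rewrite -mulr_suml -/(PX1 a); have [->|nz] := eqVneq (PX1 a) 0.
  by rewrite mul0r ler01.
by rewrite divff.
Qed.

Lemma PX1_PX21 a b : PX1 a * PX21 b a = PX a b.
Proof.
rewrite /PX21; have [z|nz] := eqVneq (PX1 a) 0; last by rewrite mulrC divfK.
rewrite z mul0r; move/eqP: z; rewrite psumr_eq0 => [|? _]; last exact: PXd.1.
by move/allP/(_ b (mem_index_enum _))/eqP ->.
Qed.

Definition uncurry2 (p : X1 * X2) : R := PX p.1 p.2.

Lemma uncurry2_sum : \sum_p uncurry2 p = 1.
Proof. by rewrite -(pair_bigA _ PX) PXd.2. Qed.

Lemma uncurry2_ge0 p : 0 <= uncurry2 p.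
Proof. exact: PXd.1. Qed.

Variable n : nat.
Hypothesis n0 : (0 < n)%N.

Definition PX1n (x1 : {ffun 'I_n -> X1}) : R := \prod_t PX1 (x1 t).
Definition PX21n (x1 : {ffun 'I_n -> X1}) (x2 : {ffun 'I_n -> X2}) : R :=
  \prod_t PX21 (x2 t) (x1 t).

Lemma PX1n_ge0 x1 : 0 <= PX1n x1.
Proof. by apply: prodr_ge0 => t _; apply: PX1_ge0. Qed.

Lemma PX21n_ge0 x1 x2 : 0 <= PX21n x1 x2.
Proof. by apply: prodr_ge0 => t _; apply: PX21_ge0. Qed.

Lemma PX1n_sum : \sum_x1 PX1n x1 = 1.
Proof.
by rewrite (sum_prod_ffun (fun=> PX1)) big1 // => t _; apply: PX1_sum.
Qed.

Lemma PX21n_sum_le1 x1 : \sum_x2 PX21n x1 x2 <= 1.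
Proof.
rewrite (sum_prod_ffun (fun t b => PX21 b (x1 t))); apply: prodr_ile1 => t _.
by rewrite PX21_sum_le1 sumr_ge0 // => b _; apply: PX21_ge0.
Qed.

Lemma PX1n_PX21n x1 x2 : PX1n x1 * PX21n x1 x2 = \prod_t PX (x1 t) (x2 t).
Proof. by rewrite -big_split; apply: eq_bigr => t _; apply: PX1_PX21. Qed.

(** A centre is good if its satellites are typical with probability at least 1/2. The restricted law
    draws a good centre, then a typical satellite. The bound on [n] makes the atypical mass at most
    1/4. *)
Lemma restricted_law (d : R) (b0 : X2) : 0 < d ->
  4 * #|{: X1 * X2}|%:R <= d ^+ 2 * n%:R ->
  exists (Q1 : {ffun 'I_n -> X1} -> R) (Q2 : {ffun 'I_n -> X1} -> {ffun 'I_n -> X2} -> R),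
  [/\ (forall x1, 0 <= Q1 x1) /\ \sum_x1 Q1 x1 = 1,
      (forall x1 x2, 0 <= Q2 x1 x2) /\ (forall x1, \sum_x2 Q2 x1 x2 = 1),
      forall x1, Q1 x1 <= 2 * PX1n x1 &
      forall x1 x2, 0 < Q1 x1 ->
        Q2 x1 x2 <= (if typical uncurry2 d (zip2 x1 x2) then 2 * PX21n x1 x2 else 0)].
Proof.
move=> d0 big.
pose typ (x1 : {ffun 'I_n -> X1}) (x2 : {ffun 'I_n -> X2}) := typical uncurry2 d (zip2 x1 x2).
pose tau x1 := \sum_(x2 | typ x1 x2) PX21n x1 x2.
pose good x1 := 2^-1 <= tau x1.
pose Zg := \sum_(x1 | good x1) PX1n x1.
have tau1 x1 : tau x1 <= 1.
  apply: le_trans (PX21n_sum_le1 x1); rewrite /tau big_mkcond; apply: ler_sum => x2 _.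
  by case: ifP => // _; apply: PX21n_ge0.
have atyp : \sum_x1 \sum_(x2 | ~~ typ x1 x2) PX1n x1 * PX21n x1 x2 <= 4^-1.
  have := atypical_prob (P := uncurry2) uncurry2_ge0 uncurry2_sum n0 d0.
  rewrite big_mkcond sum_zip2 => le; apply: le_trans (le_trans le _).
    rewrite le_eqVlt; apply/orP; left; apply/eqP.
    apply: eq_bigr => x1 _; rewrite big_mkcond; apply: eq_bigr => x2 _.
    rewrite /typ; case: ifP => // _; rewrite PX1n_PX21n.
    by apply: eq_bigr => t _; rewrite ffunE.
  rewrite ler_pdivrMr; last by rewrite mulr_gt0 ?exprn_gt0 ?ltr0n.
  by rewrite -(@ler_pM2l _ 4) // mulrA divff // mul1r.
have typ34 : 3 / 4 <= \sum_x1 PX1n x1 * tau x1.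
  have tot : \sum_x1 \sum_x2 PX1n x1 * PX21n x1 x2 = 1.
    under eq_bigr do under eq_bigr do rewrite PX1n_PX21n.
    under eq_bigr => x1 _ do rewrite (sum_prod_ffun (fun t b => PX (x1 t) b)).
    exact: PX1n_sum.
  have : \sum_x1 PX1n x1 * tau x1 +
      \sum_x1 \sum_(x2 | ~~ typ x1 x2) PX1n x1 * PX21n x1 x2 = 1.
    rewrite -tot -big_split; apply: eq_bigr => x1 _ /=.
    by rewrite mulr_sumr [RHS](bigID (typ x1)).
  lra.
(* Since [tau] is at most 1 on good centres and below 1/2 on the others, its mean, which is at least
   3/4, is at most [1/2 + Zg/2]. *)
have Zhalf : 2^-1 <= Zg.
  have : \sum_x1 PX1n x1 * tau x1 <= 2^-1 + 2^-1 * Zg.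
    have -> : 2^-1 = \sum_x1 2^-1 * PX1n x1 by rewrite -mulr_sumr PX1n_sum mulr1.
    rewrite -mulr_sumr PX1n_sum mulr1 mulr_sumr [X in _ + X]big_mkcond.
    have {1}-> : 2^-1 = \sum_x1 2^-1 * PX1n x1 by rewrite -mulr_sumr PX1n_sum mulr1.
    rewrite -big_split; apply: ler_sum => x1 _ /=.
    have p0 := PX1n_ge0 x1; have t1 := tau1 x1.
    by case: ifPn; [nra|rewrite -ltNge => lt; nra].
  lra.
have Z0 : 0 < Zg by lra.
exists (fun x1 => if good x1 then PX1n x1 / Zg else 0).
(* Bad centres have [Q1]-mass zero; the point mass at the constant sequence [b0] merely completes
   [Q2] to a law there. *)
exists (fun x1 x2 => if good x1 then (if typ x1 x2 then PX21n x1 x2 / tau x1 else 0)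
                     else (([ffun=> b0] : {ffun 'I_n -> X2}) == x2)%:R).
split.
- split; first by move=> x1; case: ifP => // _; rewrite divr_ge0 ?PX1n_ge0 // ltW.
  rewrite -(big_mkcond good (fun x1 => PX1n x1 / Zg)) -mulr_suml.
  by rewrite divff // gt_eqF.
- split=> x1.
    move=> x2; case: ifP => [g1|_]; last by rewrite ler0n.
    case: ifP => // _; rewrite divr_ge0 ?PX21n_ge0 //.
    by apply: le_trans g1; rewrite invr_ge0.
  case g1: (good x1); last first.
    by rewrite -[RHS](sum_delta ([ffun=> b0] : {ffun 'I_n -> X2}) (fun=> 1));
      apply: eq_bigr => x2 _; rewrite mulr1.
  rewrite -(big_mkcond (typ x1) (fun x2 => PX21n x1 x2 / tau x1)) -mulr_suml.
  rewrite divff // gt_eqF //.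
  by apply: lt_le_trans g1; rewrite invr_gt0.
- move=> x1; case: ifP => _; last by rewrite mulr_ge0 ?PX1n_ge0.
  have Zi : Zg^-1 <= 2 by rewrite -[leRHS]invrK lef_pV2 // posrE.
  by rewrite mulrC; exact: (ler_wpM2r (PX1n_ge0 x1) Zi).
- move=> x1 x2; case: ifP => [g1 _|_]; last by rewrite ltxx.
  have taui : (tau x1)^-1 <= 2.
    rewrite -[leRHS]invrK lef_pV2 // posrE //.
    by apply: lt_le_trans g1; rewrite invr_gt0.
  rewrite -/(typ x1 x2); case: ifP => // _.
  by rewrite mulrC; exact: (ler_wpM2r (PX21n_ge0 x1 x2) taui).
Qed.

End RestrictedLaw.

(** * Error analysis of random clouds *)

Section RandomCoding.
Variables (R : realType) (X1 X2 Y : finType) (W q : X1 -> X2 -> Y -> R).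
Hypothesis Wch : is_channel W.
Variables (n M1 M2 : nat).
Variables (Q1 : {ffun 'I_n -> X1} -> R).
Variables (Q2 : {ffun 'I_n -> X1} -> {ffun 'I_n -> X2} -> R).
Hypotheses (Q1_ge0 : forall x1, 0 <= Q1 x1) (Q1_sum : \sum_x1 Q1 x1 = 1).
Hypotheses (Q2_ge0 : forall x1 x2, 0 <= Q2 x1 x2)
  (Q2_sum : forall x1, \sum_x2 Q2 x1 x2 = 1).

(* A cloud centre with its satellites, one per message of user 2. *)
Definition cloud : finType :=
  ({ffun 'I_n -> X1} * {ffun 'I_M2 -> {ffun 'I_n -> X2}})%type.

Definition cloud_law (K : cloud) : R := Q1 K.1 * \prod_j Q2 K.1 (K.2 j).

Definition seq_score (x1 : {ffun 'I_n -> X1}) (x2 : {ffun 'I_n -> X2})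
    (y : {ffun 'I_n -> Y}) : R := \sum_t q (x1 t) (x2 t) (y t).

Definition Wn (x1 : {ffun 'I_n -> X1}) (x2 : {ffun 'I_n -> X2})
    (y : {ffun 'I_n -> Y}) : R := \prod_t W (x1 t) (x2 t) (y t).

Lemma cloud_law_ge0 K : 0 <= cloud_law K.
Proof. by rewrite mulr_ge0 // prodr_ge0. Qed.

Lemma sum_cloud (F : {ffun 'I_n -> X1} -> {ffun 'I_M2 -> {ffun 'I_n -> X2}} -> R) :
  \sum_(K : cloud) F K.1 K.2 = \sum_x1 \sum_z F x1 z.
Proof. by rewrite pair_bigA. Qed.

Lemma cloud_law_sum : \sum_K cloud_law K = 1.
Proof.
rewrite (sum_cloud (fun x1 z => Q1 x1 * \prod_j Q2 x1 (z j))) -[RHS]Q1_sum.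
apply: eq_bigr => x1 _; rewrite -mulr_sumr (sum_prod_ffun (fun=> Q2 x1)).
by rewrite big1 ?mulr1.
Qed.

Lemma cloud_marginal0 (F : {ffun 'I_n -> X1} -> R) :
  \sum_K cloud_law K * F K.1 = \sum_x1 Q1 x1 * F x1.
Proof.
rewrite (sum_cloud (fun x1 z => Q1 x1 * (\prod_j Q2 x1 (z j)) * F x1)).
apply: eq_bigr => x1 _; rewrite -mulr_suml -mulr_sumr.
by rewrite (sum_prod_ffun (fun=> Q2 x1)) [\prod__ _]big1 ?mulr1.
Qed.

Lemma cloud_marginal1 (j : 'I_M2) (F : {ffun 'I_n -> X1} -> {ffun 'I_n -> X2} -> R) :
  \sum_K cloud_law K * F K.1 (K.2 j) = \sum_x1 Q1 x1 * \sum_x2 Q2 x1 x2 * F x1 x2.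
Proof.
rewrite (sum_cloud (fun x1 z => Q1 x1 * (\prod_j Q2 x1 (z j)) * F x1 (z j))).
apply: eq_bigr => x1 _; under eq_bigr do rewrite -mulrA.
by rewrite -mulr_sumr (prod_marginal1 j (F x1)).
Qed.

Lemma cloud_marginal2 (j j' : 'I_M2)
    (F : {ffun 'I_n -> X1} -> {ffun 'I_n -> X2} -> {ffun 'I_n -> X2} -> R) :
  j != j' ->
  \sum_K cloud_law K * F K.1 (K.2 j) (K.2 j')
  = \sum_x1 Q1 x1 * \sum_x2 Q2 x1 x2 * \sum_x2' Q2 x1 x2' * F x1 x2 x2'.
Proof.
move=> jj'.
rewrite (sum_cloud (fun x1 z => Q1 x1 * (\prod_j Q2 x1 (z j)) * F x1 (z j) (z j'))).
apply: eq_bigr => x1 _; under eq_bigr do rewrite -mulrA.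
by rewrite -mulr_sumr (prod_marginal2 (F x1)).
Qed.

Variable T : {ffun 'I_n -> X1} -> {ffun 'I_n -> X2} -> {ffun 'I_n -> Y} -> bool.

(** Three causes of error: an atypical output ([A]), a rival satellite of the sent cloud ([B]), a
    rival cloud taken as a whole ([C]). A tie is an error, hence the weak comparisons of scores. *)
Let A x1 x2 := \sum_y (~~ T x1 x2 y)%:R * Wn x1 x2 y.
Let B x1 x2 x2' :=
  \sum_y (T x1 x2 y && (seq_score x1 x2 y <= seq_score x1 x2' y))%:R * Wn x1 x2 y.
Let C x1 x2 (K : cloud) :=
  \sum_y (T x1 x2 y && [exists j, seq_score x1 x2 y <= seq_score K.1 (K.2 j) y])%:R
    * Wn x1 x2 y.

Lemma seq_channel_ge0 x1 x2 y : 0 <= Wn x1 x2 y.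
Proof. exact: Wn_ge0. Qed.

Definition cloud_code (om : {ffun 'I_M1 -> cloud}) : Defs.code X1 X2 n M1 M2 :=
  Code (fun i => (om i).1) (fun i j => (om i).2 j).

Lemma msg_err_union (om : {ffun 'I_M1 -> cloud}) w1 w2 x1 x2 :
  x1 = (om w1).1 -> x2 = (om w1).2 w2 ->
  msg_err W q (cloud_code om) w1 w2 <=
    A x1 x2 + \sum_(j | j != w2) B x1 x2 ((om w1).2 j)
    + \sum_(i | i != w1) C x1 x2 (om i).
Proof.
move=> x1E x2E; rewrite /A /B /C [X in _ <= _ + X + _]exchange_big [X in _ <= _ + X]exchange_big.
rewrite -!big_split /=; apply: ler_sum => y _.
rewrite -[X in X * _ <= _]/(Wn (om w1).1 ((om w1).2 w2) y) -x1E -x2E.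
have W0 := seq_channel_ge0 x1 x2 y; have bW0 (b : bool) : 0 <= b%:R * Wn x1 x2 y.
  by rewrite mulr_ge0.
have sum0 (I : finType) (D : pred I) (E : I -> bool) :
    0 <= \sum_(i | D i) (E i)%:R * Wn x1 x2 y.
  by apply: sumr_ge0 => i _; apply: bW0.
case: ifPn => [_|]; first by rewrite mulr0 !addr_ge0.
rewrite negb_forall => /existsP[i]; rewrite negb_forall => /existsP[j].
rewrite negb_imply -leNgt [score _ _ w1 w2 y]/(seq_score (om w1).1 ((om w1).2 w2) y) -x1E -x2E.
move=> /andP[neq le].
rewrite mulr1; have [Ty|nT] := boolP (T x1 x2 y); last first.
  by rewrite mul1r -addrA lerDl addr_ge0.
have [iw|iw] := eqVneq i w1.
  have jw : j != w2 by apply: contraNneq neq => ->; rewrite iw.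
  rewrite mul0r add0r (bigD1 j) //=; move: le.
  rewrite iw -[score _ _ _ _ _]/(seq_score (om w1).1 ((om w1).2 j) y) -x1E => ->.
  by rewrite mul1r -addrA lerDl addr_ge0.
rewrite mul0r add0r addrC (bigD1 i) //=.
have -> : [exists k, seq_score x1 x2 y <= seq_score (om i).1 ((om i).2 k) y].
  by apply/existsP; exists j.
by rewrite mul1r -addrA lerDl addr_ge0.
Qed.

Hypotheses (eA b c : R).
Hypothesis hA : \sum_x1 Q1 x1 * \sum_x2 Q2 x1 x2 *
  \sum_(y | ~~ T x1 x2 y) Wn x1 x2 y <= eA.
Hypothesis hB : forall x1 x2 y, 0 < Q1 x1 -> T x1 x2 y ->
  \sum_(x2' | seq_score x1 x2 y <= seq_score x1 x2' y) Q2 x1 x2' <= b.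
Hypothesis hC : forall x1 x2 y, T x1 x2 y ->
  \sum_(K : cloud | [exists j, seq_score x1 x2 y <= seq_score K.1 (K.2 j) y])
    cloud_law K <= c.
Hypotheses (b_ge0 : 0 <= b) (c_ge0 : 0 <= c).

(** Null outcomes are skipped, so that [hB] need only hold on the support of [Q1], where [Q2] is
    controlled. *)
Lemma mean_le (I : finType) (P F : I -> R) k :
  (forall i, 0 <= P i) -> \sum_i P i = 1 -> (forall i, 0 < P i -> F i <= k) ->
  \sum_i P i * F i <= k.
Proof.
move=> P0 P1 Fk; rewrite -[leRHS]mul1r -P1 mulr_suml; apply: ler_sum => i _.
have := P0 i; rewrite le_eqVlt => /orP[/eqP <-|Pi]; first by rewrite !mul0r.
by rewrite ler_pM2l // Fk.
Qed.

(** The rival is drawn independently of the output once the sent codewords are fixed. The sums can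
    be exchanged and the rival bounded for each fixed [y]. *)
Lemma channel_mean_le (I : finType) (P : I -> R) (x1 : {ffun 'I_n -> X1})
    (x2 : {ffun 'I_n -> X2}) (E : I -> {ffun 'I_n -> Y} -> bool) k :
  0 <= k -> (forall y, T x1 x2 y -> \sum_(i | E i y) P i <= k) ->
  \sum_i P i * (\sum_y (T x1 x2 y && E i y)%:R * Wn x1 x2 y) <= k.
Proof.
move=> k0 Ek; under eq_bigr do rewrite mulr_sumr.
rewrite exchange_big /=.
have -> : \sum_y \sum_i P i * ((T x1 x2 y && E i y)%:R * Wn x1 x2 y)
  = \sum_y Wn x1 x2 y * (\sum_i P i * (T x1 x2 y && E i y)%:R).
  apply: eq_bigr => y _; rewrite mulr_sumr; apply: eq_bigr => i _; by ring.
apply: mean_le => [y||y _]; [exact: seq_channel_ge0|exact: Wn_sum1|].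
have [Ty|_] := boolP (T x1 x2 y); last by rewrite big1 // => i _; rewrite mulr0.
apply: le_trans (Ek y Ty); rewrite [leRHS]big_mkcond; apply: ler_sum => i _ /=.
by case: (E i y); rewrite ?mulr1 ?mulr0.
Qed.

Lemma random_coding : ensemble W q n M1 M2 (eA + M2.-1%:R * b + M1.-1%:R * c).
Proof.
exists {ffun 'I_M1 -> cloud}, (fun om : {ffun 'I_M1 -> cloud} => \prod_i cloud_law (om i)), cloud_code; split.
- by move=> om; apply: prodr_ge0 => i _; apply: cloud_law_ge0.
- by rewrite (sum_prod_ffun (fun=> cloud_law)) big1 // => i _; apply: cloud_law_sum.
move=> w1 w2; set mu := fun om : {ffun 'I_M1 -> cloud} => \prod_i cloud_law (om i).
pose A' (K : cloud) := A K.1 (K.2 w2).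
pose B' (K : cloud) := \sum_(j | j != w2) B K.1 (K.2 w2) (K.2 j).
pose C' (K K' : cloud) := C K.1 (K.2 w2) K'.
apply: (@le_trans _ _ (\sum_om mu om * A' (om w1) + \sum_om mu om * B' (om w1)
   + \sum_(i | i != w1) \sum_om mu om * C' (om w1) (om i))).
  rewrite [X in _ <= _ + X]exchange_big -!big_split /=; apply: ler_sum => om _.
  rewrite -mulr_sumr -!mulrDr; apply: ler_wpM2l; last exact: msg_err_union.
  by apply: prodr_ge0 => i _; apply: cloud_law_ge0.
rewrite !(prod_marginal1 _ _ cloud_law_sum).
have const_sum (m : nat) (w : 'I_m) (k : R) : m.-1%:R * k = \sum_(j | j != w) k.
  by rewrite (eq_bigl (mem (predC1 w))) // sumr_const cardC1 card_ord mulr_natl.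
apply: lerD; first apply: lerD.
- rewrite (cloud_marginal1 w2 A); apply: le_trans hA.
  apply: ler_sum => x1 _; apply: ler_wpM2l => //; apply: ler_sum => x2 _.
  apply: ler_wpM2l => //; rewrite [leRHS]big_mkcond; apply: ler_sum => y _.
  by case: (T x1 x2 y); rewrite ?mul0r ?mul1r.
- rewrite (const_sum _ w2) /B'.
  under eq_bigr do rewrite mulr_sumr.
  rewrite exchange_big /=; apply: ler_sum => j jw.
  (* Satellites of one cloud are independent only given their centre; clouds, treated next, are
     independent outright. *)
  rewrite (cloud_marginal2 B) 1?eq_sym //.
  apply: mean_le => // x1 Q1x1; apply: mean_le => // x2 _.
  by apply: channel_mean_le => // y; apply: hB.
- rewrite (const_sum _ w1).
  apply: ler_sum => i iw; rewrite (prod_marginal2 C' cloud_law_sum) 1?eq_sym //.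
  apply: mean_le => [K||K _]; [exact: cloud_law_ge0|exact: cloud_law_sum|].
  by apply: channel_mean_le => // y; apply: hC.
Qed.

End RandomCoding.

(** * Uniform rate margins near the constraint sets *)

Section Slack.
Variables (R : realType) (X1 X2 Y : finType) (W q : X1 -> X2 -> Y -> R).
Variable PX : X1 -> X2 -> R.
Hypothesis Wch : is_channel W.
Let P := joint PX W.

Lemma m12_joint a b : m12 P a b = PX a b.
Proof. by rewrite /m12 /P /joint -mulr_sumr Wch.2 mulr1. Qed.

(* Quantities vanishing at a distribution exactly when it lies in [L0], resp. [L2]. *)
Definition base_slack (f : dist3 R X1 X2 Y) : R :=
  \sum_a \sum_b `|m12 f a b - PX a b| + Num.max 0 (Eq q P - Eq q f)
  + `|\sum_a \sum_b \sum_c f a b c - 1|.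
Definition slack0 (f : dist3 R X1 X2 Y) : R :=
  base_slack f + \sum_c `|m3 f c - m3 P c|.
Definition slack2 (f : dist3 R X1 X2 Y) : R :=
  base_slack f + \sum_a \sum_c `|m13 f a c - m13 P a c|.

Lemma base_slack_ge0 f : 0 <= base_slack f.
Proof.
rewrite /base_slack; apply: addr_ge0 => //; apply: addr_ge0; last by rewrite le_max lexx.
by do 2!apply: sumr_ge0 => ? _.
Qed.

Lemma slack0_ge0 f : 0 <= slack0 f.
Proof. by apply: addr_ge0; [exact: base_slack_ge0|apply: sumr_ge0]. Qed.

Lemma slack2_ge0 f : 0 <= slack2 f.
Proof.
by apply: addr_ge0; [exact: base_slack_ge0|do 2!apply: sumr_ge0 => ? _].
Qed.

Lemma cts_base_slack : cts base_slack.
Proof.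
apply: cts_add; first apply: cts_add.
- do 2!apply: cts_sum => ?; apply/cts_norm/cts_sub; [exact: cts_m12|exact: cts_cst].
- by apply: cts_max; [exact: cts_cst|apply: cts_sub; [exact: cts_cst|exact: cts_Eq]].
- apply/cts_norm/cts_sub; last exact: cts_cst.
  by do 3!apply: cts_sum => ?; exact: cts_coord.
Qed.

Lemma cts_slack0 : cts slack0.
Proof.
apply: cts_add; first exact: cts_base_slack.
by apply: cts_sum => c; apply/cts_norm/cts_sub; [exact: cts_m3|exact: cts_cst].
Qed.

Lemma cts_slack2 : cts slack2.
Proof.
apply: cts_add; first exact: cts_base_slack.
by do 2!apply: cts_sum => ?; apply/cts_norm/cts_sub; [exact: cts_m13|exact: cts_cst].
Qed.

Lemma sum_norm_eq0 (I : finType) (F : I -> R) :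
  \sum_i `|F i| = 0 -> forall i, F i = 0.
Proof.
move=> /eqP; rewrite psumr_eq0 // => /allP z i.
by have := z i (mem_index_enum _); rewrite normr_eq0 => /eqP.
Qed.

Lemma sum2_norm_eq0 (I J : finType) (F : I -> J -> R) :
  \sum_i \sum_j `|F i j| = 0 -> forall i j, F i j = 0.
Proof.
by rewrite pair_bigA => /sum_norm_eq0 z i j; have := z (i, j).
Qed.

Lemma base_slack_Gq f : (forall a b c, 0 <= f a b c) -> base_slack f = 0 -> Gq q P f.
Proof.
move=> f0 /eqP; rewrite paddr_eq0 //; last first.
  by apply: addr_ge0; [do 2!apply: sumr_ge0 => ? _|rewrite le_max lexx].
rewrite paddr_eq0; last by rewrite le_max lexx.
  move=> /andP[/andP[/eqP/sum2_norm_eq0 z /eqP e]]; rewrite normr_eq0 subr_eq0.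
  move=> /eqP f1; split; first by split.
  split=> [a b|]; first by rewrite m12_joint; apply/eqP; rewrite -subr_eq0 z.
  have : Eq q P - Eq q f <= Num.max 0 (Eq q P - Eq q f) by rewrite le_max lexx orbT.
  by rewrite e subr_le0.
by do 2!apply: sumr_ge0 => ? _.
Qed.

Lemma slack0_L0 f : (forall a b c, 0 <= f a b c) -> slack0 f = 0 -> L0 q P f.
Proof.
move=> f0 /eqP; rewrite paddr_eq0 ?base_slack_ge0 ?sumr_ge0 //.
move=> /andP[/eqP/(base_slack_Gq f0) G /eqP/sum_norm_eq0 z]; split => // c.
by apply/eqP; rewrite -subr_eq0 z.
Qed.

Lemma slack2_L2 f : (forall a b c, 0 <= f a b c) -> slack2 f = 0 -> L2 q P f.
Proof.
move=> f0 /eqP; rewrite paddr_eq0 ?base_slack_ge0 //; last first.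
  by do 2!apply: sumr_ge0 => ? _.
move=> /andP[/eqP/(base_slack_Gq f0) G /eqP/sum2_norm_eq0 z]; split => // a c.
by apply/eqP; rewrite -subr_eq0 z.
Qed.

Variables (r : R * R) (eta : R).
Hypotheses (rP : Rcog q P r) (eta0 : 0 < eta).

Lemma gap2 : exists2 d, 0 < d & forall f, is_dist3 f -> slack2 f < d ->
  r.2 - eta + d <= MI_X2Y_given_X1 f.
Proof.
case: rP => _ [_ [r2 _]].
have [||||d d0 dP] := @compactness_gap _ _ _ _ slack2
  (fun f => cMI_X2Y_given_X1 f - (r.2 - eta)).
- exact: cts_slack2.
- by apply: cts_sub; [exact: cts_cMI_X2Y_given_X1|exact: cts_cst].
- exact: slack2_ge0.
- move=> f f0 /(slack2_L2 f0) fL2; rewrite -MI_X2Y_given_X1E //.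
  have : r.2 <= MI_X2Y_given_X1 f.
    by rewrite -lee_fin; apply: le_trans r2 _; apply: ereal_inf_lbound; exists f.
  by move=> h; rewrite subr_gt0; apply: lt_le_trans h; rewrite ltrBlDr ltrDl.
exists d => // f fd fs; have /= := dP f fd fs; rewrite MI_X2Y_given_X1E; last exact: fd.1.
by rewrite lerBrDr addrC.
Qed.

(** On [L0] either [I(X1;Y)] exceeds [r.1], or [f] belongs to [L0_below] and the sum-rate bound
    applies. The back-off [eta] makes one margin strictly positive, so compactness applies to their
    maximum. *)
Lemma gap0 : exists2 d, 0 < d & forall f, is_dist3 f -> slack0 f < d ->
  (r.1 - eta + d <= MI_X1Y f) \/ (r.1 + r.2 - eta + d <= MI_X1X2Y f).
Proof.
case: rP => _ [_ [_ r12]].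
have [||||d d0 dP] := @compactness_gap _ _ _ _ slack0
  (fun f => Num.max (cMI_X1Y f - (r.1 - eta)) (cMI_X1X2Y f - (r.1 + r.2 - eta))).
- exact: cts_slack0.
- apply: cts_max; apply: cts_sub; try exact: cts_cst.
    exact: cts_cMI_X1Y.
  exact: cts_cMI_X1X2Y.
- exact: slack0_ge0.
- move=> f f0 /(slack0_L0 f0) fL0; rewrite -MI_X1YE // -MI_X1X2YE // lt_max.
  have [le|gt] := leP (MI_X1Y f) r.1; apply/orP; [right|left].
  have : r.1 + r.2 <= MI_X1X2Y f.
    by rewrite -lee_fin; apply: le_trans r12 _; apply: ereal_inf_lbound; exists f.
    by move=> h; rewrite subr_gt0; apply: lt_le_trans h; rewrite ltrBlDr ltrDl.
  by rewrite subr_gt0; apply: lt_trans gt; rewrite ltrBlDr ltrDl.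
exists d => // f fd fs; have /= := dP f fd fs.
rewrite -MI_X1YE; last exact: fd.1.
rewrite -MI_X1X2YE; last exact: fd.1.
by rewrite le_max => /orP[h|h]; [left|right]; rewrite addrC -lerBrDr.
Qed.

End Slack.

Section Closeness.
Variables (R : realType) (X1 X2 Y : finType) (W q : X1 -> X2 -> Y -> R).
Variable PX : X1 -> X2 -> R.
Let P := joint PX W.

Definition uncurry3 (f : dist3 R X1 X2 Y) (p : X1 * X2 * Y) : R := f p.1.1 p.1.2 p.2.

(** The summands account for the input marginal, the metric and the output marginals, each deviating
    by at most [d] per cell. *)
Definition slack_const : R :=
  #|{: X1 * X2}|%:R + \sum_a \sum_b \sum_c `|q a b c| + #|{: X1 * X2 * Y}|%:R.

Variables (n : nat) (d : R).
Hypotheses (n0 : (0 < n)%N) (d0 : 0 <= d).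
Variables (x1 x1' : {ffun 'I_n -> X1}) (x2 x2' : {ffun 'I_n -> X2}) (y : {ffun 'I_n -> Y}).
Hypothesis typ3 : typical (uncurry3 P) d (zip2 (zip2 x1 x2) y).
Hypothesis typ2 : typical (uncurry2 PX) d (zip2 x1' x2').
Hypothesis score_le : seq_score q x1 x2 y <= seq_score q x1' x2' y.

Let g := joint_type R x1 x2 y.
Let f := joint_type R x1' x2' y.

Lemma type_close a b c : `|g a b c - P a b c| <= d.
Proof. exact: (forallP typ3 (a, b, c)). Qed.

(** The score deficit is controlled through the true type [g]: the rival scores no less than [g],
    whose mean metric is within [d] times the sum of [|q|] of that of [P]. *)
Lemma base_slack_close : base_slack W q PX f
  <= d * (#|{: X1 * X2}|%:R + \sum_a \sum_b \sum_c `|q a b c|).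
Proof.
rewrite mulrDr /base_slack (joint_type_dist R n0 _ _ _).2 subrr normr0 addr0; apply: lerD.
  rewrite pair_bigA mulr_natr -sumr_const; apply: ler_sum => -[a b] _ /=.
  by rewrite m12_type; exact: (forallP typ2 (a, b)).
rewrite ge_max; apply/andP; split.
  by rewrite mulr_ge0 //; do 3!apply: sumr_ge0 => ? _.
have : Eq q g <= Eq q f.
  by rewrite !Eq_type ler_pM2l // invr_gt0 ltr0n.
suff : Eq q P - Eq q g <= d * (\sum_a \sum_b \sum_c `|q a b c|) by lra.
rewrite /Eq -sumrB mulr_sumr; apply: ler_sum => a _.
rewrite -sumrB mulr_sumr; apply: ler_sum => b _.
rewrite -sumrB mulr_sumr; apply: ler_sum => c _.
rewrite -mulrBl; apply: le_trans (ler_norm _) _; rewrite normrM.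
by apply: ler_wpM2r => //; rewrite distrC; apply: type_close.
Qed.

Lemma sum3_close : \sum_a \sum_b \sum_c `|g a b c - P a b c| <= d * #|{: X1 * X2 * Y}|%:R.
Proof.
rewrite -(sum_dist3 (fun p => `|g p.1.1 p.1.2 p.2 - P p.1.1 p.1.2 p.2|)).
rewrite mulr_natr -sumr_const; apply: ler_sum => -[[a b] c] _.
exact: type_close.
Qed.

(** The wrong pair is compared with the same output, so [f] and [g] share the [Y]-marginal. In
    [slack2_close] the shared centre gives them the same [(X1, Y)]-marginal. *)
Lemma slack0_close : slack0 W q PX f <= d * slack_const.
Proof.
rewrite /slack_const mulrDr; apply: lerD; first exact: base_slack_close.
apply: le_trans sum3_close.
under [leRHS]eq_bigr do rewrite exchange_big.
rewrite [leRHS]exchange_big; apply: ler_sum => c _ /=.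
have -> : m3 f c = m3 g c by rewrite !m3_type.
rewrite /m3 -sumrB; apply: le_trans (ler_norm_sum _ _ _) _; apply: ler_sum => a _.
by rewrite -sumrB; apply: ler_norm_sum.
Qed.

Lemma slack2_close : x1 = x1' -> slack2 W q PX f <= d * slack_const.
Proof.
move=> x1E; rewrite /slack_const mulrDr; apply: lerD; first exact: base_slack_close.
apply: le_trans sum3_close; apply: ler_sum => a _.
rewrite [leRHS]exchange_big; apply: ler_sum => c _ /=.
have -> : m13 f a c = m13 g a c by rewrite !m13_type x1E.
by rewrite /m13 -sumrB; apply: ler_norm_sum.
Qed.

End Closeness.

(** The exponential dominates its Taylor term of degree [K + 1], and [n + 1 <= 2 n]; what is left is
    [C / n]. *)
Lemma poly_exp_small (R : realType) (K : nat) (d eps : R) : 0 < d -> 0 < eps ->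
  exists N, forall n, (N <= n)%N ->
    (n.+1 ^ K)%:R * 2 `^ (- (n%:R * d)) <= eps.
Proof.
move=> d0 eps0; have l2 : 0 < ln 2 :> R by rewrite ln_gt0 // ltr1n.
pose k := d * ln 2; have k0 : 0 < k by rewrite mulr_gt0.
pose C : R := (2 ^ K)%:R * K.+1`!%:R / k ^+ K.+1.
have C0 : 0 <= C by rewrite !mulr_ge0 // invr_ge0 exprn_ge0 // ltW.
have [N hN] := exists_nat_ge (C / eps).
exists (maxn 1 N) => n; rewrite geq_max => /andP[n1 Nn].
have np : 0 < n%:R :> R by rewrite ltr0n.
have {}hN := hN n Nn; rewrite ler_pdivrMr // in hN.
pose x := n%:R * k; have x0 : 0 < x by rewrite mulr_gt0.
have xe : x ^+ K.+1 / K.+1`!%:R <= expR x.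
  by apply: le_trans (expR_ge1Dxn K (ltW x0)); rewrite lerDr.
have fpos : 0 < K.+1`!%:R :> R by rewrite ltr0n fact_gt0.
have xp : 0 < x ^+ K.+1 by rewrite exprn_gt0.
have -> : 2 `^ (- (n%:R * d)) = (expR x)^-1.
  by rewrite powRN /powR pnatr_eq0 /= /x /k mulrA.
have step : (expR x)^-1 <= K.+1`!%:R / x ^+ K.+1.
  rewrite -[leRHS]invrK invf_div lef_pV2 ?posrE ?expR_gt0 //.
  by rewrite divr_gt0.
have n2 : (n.+1 ^ K)%:R <= (2 ^ K)%:R * n%:R ^+ K :> R.
  rewrite -natrX -natrM ler_nat -expnMn.
  have n2 : (n.+1 <= 2 * n)%N by rewrite mul2n -addnn -addn1 leq_add2l.
  by case: (K) => [|K']; rewrite ?expn0 // leq_exp2r.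
have e0 : 0 <= (expR x)^-1 by rewrite invr_ge0 expR_ge0.
apply: le_trans (ler_pM (ler0n _ _) e0 n2 step) _.
have -> : (2 ^ K)%:R * n%:R ^+ K * (K.+1`!%:R / x ^+ K.+1) = C / n%:R.
  rewrite /C /x exprMn exprS; field.
  by rewrite !gt_eqF ?exprn_gt0.
by rewrite ler_pdivrMr // mulrC.
Qed.

(** * Exponents of the error events and choice of parameters *)

Section Superposition.
Variables (R : realType) (X1 X2 Y : finType) (W q : X1 -> X2 -> Y -> R).
Variable PX : X1 -> X2 -> R.
Hypotheses (Wch : is_channel W) (PXd : is_dist2 PX).
Let P := joint PX W.

(** The number of rivals obeys the rate even when it is negative: the single message then allowed
    has no rival. *)
Lemma size_le_pred n (r : R) M : size_le n r M -> M.-1%:R <= 2 `^ (n%:R * r).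
Proof.
rewrite /size_le le_max => /orP[M1|Mle].
  have {}M1 : (M <= 1)%N by rewrite -(ler_nat R).
  by case: M M1 => [|[|]] // _; apply: powR_ge0.
by apply: le_trans Mle; rewrite ler_nat leq_pred.
Qed.

Lemma uncurry3_sum : \sum_p uncurry3 P p = 1.
Proof.
rewrite sum_dist3 -PXd.2; apply: eq_bigr => a _; apply: eq_bigr => b _.
exact: m12_joint.
Qed.

Lemma uncurry3_ge0 p : 0 <= uncurry3 P p.
Proof. by rewrite mulr_ge0 //; [exact: PXd.1|exact: Wch.1]. Qed.

Section FixedBlocklength.
Variables (n M1 M2 : nat) (d delta eta : R) (r : R * R).
Hypotheses (n0 : (0 < n)%N) (d0 : 0 < d) (eta0 : 0 < eta).
Hypotheses (r20 : 0 <= r.2).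
Hypothesis gap0P : forall f, is_dist3 f -> slack0 W q PX f < delta ->
  (r.1 - eta + delta <= MI_X1Y f) \/ (r.1 + r.2 - eta + delta <= MI_X1X2Y f).
Hypothesis gap2P : forall f, is_dist3 f -> slack2 W q PX f < delta ->
  r.2 - eta + delta <= MI_X2Y_given_X1 f.
Hypothesis d_small : d * slack_const q < delta.
Hypotheses (sz1 : size_le n (r.1 - eta) M1) (sz2 : size_le n (r.2 - eta) M2).

Variables (Q1 : {ffun 'I_n -> X1} -> R).
Variables (Q2 : {ffun 'I_n -> X1} -> {ffun 'I_n -> X2} -> R).
Hypotheses (Q1_ge0 : forall x1, 0 <= Q1 x1) (Q1_sum : \sum_x1 Q1 x1 = 1).
Hypotheses (Q2_ge0 : forall x1 x2, 0 <= Q2 x1 x2)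
  (Q2_sum : forall x1, \sum_x2 Q2 x1 x2 = 1).
Hypothesis Q1_le : forall x1, Q1 x1 <= 2 * PX1n PX x1.
Hypothesis Q2_le : forall x1 x2, 0 < Q1 x1 ->
  Q2 x1 x2 <= (if typical (uncurry2 PX) d (zip2 x1 x2) then 2 * PX21n PX x1 x2 else 0).

Let T (x1 : {ffun 'I_n -> X1}) (x2 : {ffun 'I_n -> X2}) (y : {ffun 'I_n -> Y}) :=
  typical (uncurry3 P) d (zip2 (zip2 x1 x2) y).
Let ntypes : R := (n.+1 ^ #|{: X1 * X2 * Y}|)%:R.

Lemma Q2_typical x1 x2 : 0 < Q1 x1 -> 0 < Q2 x1 x2 ->
  typical (uncurry2 PX) d (zip2 x1 x2).
Proof.
move=> q1 q2; have := lt_le_trans q2 (Q2_le x2 q1).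
by case: ifP => //; rewrite ltxx.
Qed.

Lemma Q2_le_PX21n x1 x2 : 0 < Q1 x1 -> Q2 x1 x2 <= 2 * PX21n PX x1 x2.
Proof.
move=> q1; apply: le_trans (Q2_le x2 q1) _; case: ifP => // _.
by rewrite mulr_ge0 // PX21n_ge0.
Qed.

Lemma Q12_le x1 x2 : Q1 x1 * Q2 x1 x2 <= 4 * \prod_t PX (x1 t) (x2 t).
Proof.
have := Q1_ge0 x1; rewrite le_eqVlt => /orP[/eqP <-|q1].
  by rewrite mul0r mulr_ge0 // prodr_ge0 // => t _; exact: PXd.1.
rewrite -(PX1n_PX21n PXd).
have -> : 4 * (PX1n PX x1 * PX21n PX x1 x2) = 2 * PX1n PX x1 * (2 * PX21n PX x1 x2) by ring.
by apply: ler_pM => //; exact: Q2_le_PX21n.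
Qed.

Lemma atypical_bound : \sum_x1 Q1 x1 * \sum_x2 Q2 x1 x2 *
    \sum_(y | ~~ T x1 x2 y) Wn W x1 x2 y
  <= 4 * (#|{: X1 * X2 * Y}|%:R / (d ^+ 2 * n%:R)).
Proof.
have at3 := atypical_prob uncurry3_ge0 uncurry3_sum n0 d0.
rewrite -(@ler_pM2l _ 4) // in at3; apply: le_trans at3.
rewrite [in leRHS]big_mkcond sum_zip2 sum_zip2 mulr_sumr; apply: ler_sum => x1 _.
rewrite !mulr_sumr; apply: ler_sum => x2 _; rewrite mulrA.
apply: le_trans (ler_wpM2r _ (Q12_le x1 x2)) _.
  by apply: sumr_ge0 => y _; exact: Wn_ge0.
rewrite -mulrA ler_pM2l // mulr_sumr big_mkcond; apply: ler_sum => y _.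
rewrite -/(T x1 x2 y); case: ifP => // _; rewrite -big_split le_eqVlt.
by apply/orP; left; apply/eqP; apply: eq_bigr => t _; rewrite !ffunE.
Qed.

Lemma satellite_bound x1 x2 y : 0 < Q1 x1 -> T x1 x2 y ->
  \sum_(x2' | seq_score q x1 x2 y <= seq_score q x1 x2' y) Q2 x1 x2'
    <= ntypes * (2 * 2 `^ (- (n%:R * (r.2 - eta + delta)))).
Proof.
move=> q1 Ty.
(* Null rivals are discarded so that the representative of each type class is typical with [x1]. *)
pose E x2' (_ : unit) := (seq_score q x1 x2 y <= seq_score q x1 x2' y) && (0 < Q2 x1 x2').
pose z (x2' : {ffun 'I_n -> X2}) (_ : unit) := zip2 (zip2 x1 x2') y.
apply: (@le_trans _ _ (\sum_(x2' | [exists j, E x2' j]) Q2 x1 x2')).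
  rewrite big_mkcond [leRHS]big_mkcond; apply: ler_sum => x2' _; case: ifP => [le|_].
    have := Q2_ge0 x1 x2'; rewrite le_eqVlt => /orP[/eqP <-|pos]; first by case: ifP.
    by rewrite ifT //; apply/existsP; exists tt; rewrite /E le pos.
  by case: ifP.
apply: (type_union (E := E) (z := z)) => [//||k0 u /andP[le pos]].
  by rewrite mulr_ge0 // powR_ge0.
have fd := joint_type_dist R n0 x1 k0 y.
have fs : slack2 W q PX (joint_type R x1 k0 y) < delta.
  apply: le_lt_trans d_small.
  by apply: (slack2_close n0 (ltW d0) Ty _ le) => //; apply: Q2_typical.
have MIge := gap2P fd fs.
apply: (@le_trans _ _ (2 * \sum_(k | same_type R (zip2 (zip2 x1 k) y) (zip2 (zip2 x1 k0) y))
   PX21n PX x1 k)).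
  rewrite mulr_sumr big_mkcond [leRHS]big_mkcond; apply: ler_sum => k _.
  case: ifP => [/existsP[v /andP[_ same]]|_].
    by rewrite ifT //; apply: Q2_le_PX21n.
  by case: ifP => // _; rewrite mulr_ge0 // PX21n_ge0.
rewrite ler_pM2l //; apply: le_trans (class_prob_X2 n0 _ _ _) _.
- exact: PX21_ge0.
- exact: PX21_sum_le1.
- by move=> k /forallP same p; apply/eqP.
by apply: powR2_mono; rewrite lerN2 ler_pM2l ?ltr0n.
Qed.

Lemma same_type_X1Y (x1 x1' : {ffun 'I_n -> X1}) (x2 x2' : {ffun 'I_n -> X2})
    (y : {ffun 'I_n -> Y}) :
  same_type R (zip2 (zip2 x1 x2) y) (zip2 (zip2 x1' x2') y) ->
  same_type R (zip2 x1 y) (zip2 x1' y).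
Proof.
move=> /forallP same; apply/forallP => c; apply/eqP.
have zE (u : {ffun 'I_n -> X1}) (v : {ffun 'I_n -> X2}) : zip2 u y =
    [ffun t => ((zip2 (zip2 u v) y t).1.1, (zip2 (zip2 u v) y t).2)].
  by apply/ffunP => t; rewrite !ffunE.
rewrite (zE x1 x2) (zE x1' x2') !(emp_map _ (fun p : X1 * X2 * Y => (p.1.1, p.2))).
by apply: eq_bigr => p _; rewrite (eqP (same p)).
Qed.

Lemma cloud_bound x1 x2 y : T x1 x2 y ->
  \sum_(K : cloud X1 X2 n M2 |
      [exists j, seq_score q x1 x2 y <= seq_score q K.1 (K.2 j) y]) cloud_law Q1 Q2 K
    <= ntypes * (4 * 2 `^ (- (n%:R * (r.1 - eta + delta)))).
Proof.
move=> Ty; pose nu (K : cloud X1 X2 n M2) := cloud_law Q1 Q2 K.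
have nu0 K : 0 <= nu K by apply: cloud_law_ge0.
pose E (K : cloud X1 X2 n M2) (j : 'I_M2) :=
  (seq_score q x1 x2 y <= seq_score q K.1 (K.2 j) y) && (0 < nu K).
pose z (K : cloud X1 X2 n M2) (j : 'I_M2) := zip2 (zip2 K.1 (K.2 j)) y.
apply: (@le_trans _ _ (\sum_(K | [exists j, E K j]) nu K)).
  rewrite big_mkcond [leRHS]big_mkcond; apply: ler_sum => K _; case: ifP => [/existsP[j le]|_].
    have := nu0 K; rewrite le_eqVlt => /orP[/eqP z0|pos]; first by rewrite -/(nu K) -z0; case: ifP.
    by rewrite ifT //; apply/existsP; exists j; rewrite /E le pos.
  by case: ifP => // _; exact: nu0.
apply: (type_union (E := E) (z := z)) => [//||K0 j0 /andP[le pos]].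
  by rewrite mulr_ge0 // powR_ge0.
have Q1K : 0 < Q1 K0.1.
  rewrite lt_def Q1_ge0 andbT; apply: contraTneq pos => Q10.
  by rewrite /nu /cloud_law Q10 mul0r ltxx.
have Q2K : 0 < Q2 K0.1 (K0.2 j0).
  rewrite lt_def Q2_ge0 andbT; apply: contraTneq pos => Q20.
  by rewrite /nu /cloud_law (bigD1 j0) //= Q20 mul0r mulr0 ltxx.
have fd := joint_type_dist R n0 K0.1 (K0.2 j0) y.
have fs : slack0 W q PX (joint_type R K0.1 (K0.2 j0) y) < delta.
  apply: le_lt_trans d_small.
  by apply: (slack0_close n0 (ltW d0) Ty _ le); apply: Q2_typical.
(* The alternative is decided by the representative of the type class. In the first case the centre
   alone must have the right type with [y], whichever satellite wins, so no union over satellites is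
   paid. *)
case: (gap0P fd fs) => MIge.
  pose D (x : {ffun 'I_n -> X1}) := same_type R (zip2 x y) (zip2 K0.1 y).
  apply: (@le_trans _ _ (\sum_(K : cloud X1 X2 n M2) nu K * (D K.1)%:R)).
    rewrite big_mkcond; apply: ler_sum => K _.
    case: ifP => [/existsP[j /andP[_ /same_type_X1Y same]]|_].
      by rewrite /D same mulr1.
    by rewrite mulr_ge0 // nu0.
  rewrite (cloud_marginal0 _ _ Q2_sum (fun x => (D x)%:R)).
  apply: (@le_trans _ _ (2 * \sum_(x | D x) PX1n PX x)).
    rewrite mulr_sumr [leRHS]big_mkcond; apply: ler_sum => x _.
    by case: (D x); rewrite ?mulr1 ?mulr0.
  have := class_prob_X1 (D := D) (x1' := K0.1) (y := y) n0 (K0.2 j0) (PX1_ge0 PXd).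
  rewrite PX1_sum // => /(_ (lexx _)) cb.
  apply: le_trans (ler_wpM2l _ (cb _)) _ => //.
    by move=> x /forallP same p; apply/eqP.
  set u := 2 `^ _; set v := 2 `^ _.
  have uv : u <= v by apply: powR2_mono; rewrite lerN2 ler_pM2l ?ltr0n.
  have u0 : 0 <= u by apply: powR_ge0.
  lra.
pose D (x : {ffun 'I_n -> X1}) (x' : {ffun 'I_n -> X2}) := same_type R (zip2 (zip2 x x') y) (zip2 (zip2 K0.1 (K0.2 j0)) y).
apply: (@le_trans _ _ (\sum_(j < M2) \sum_(K : cloud X1 X2 n M2) nu K * (D K.1 (K.2 j))%:R)).
  rewrite exchange_big big_mkcond; apply: ler_sum => K _.
  case: ifP => [/existsP[j /andP[_ same]]|_]; last first.
    by apply: sumr_ge0 => j _; rewrite mulr_ge0 // nu0.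
  rewrite (bigD1 j) //= /D same mulr1 lerDl sumr_ge0 // => k _.
  by rewrite mulr_ge0 // nu0.
(* The union over satellites costs [r.2], which turns the exponent [r.1 + r.2 - eta + delta] into
   that of the first case. *)
have M2le : M2%:R <= 2 `^ (n%:R * r.2).
  apply: le_trans sz2 _; rewrite ge_max; apply/andP; split.
    by rewrite -[leLHS](powRr0 2); apply: powR2_mono; rewrite mulr_ge0.
  by apply: powR2_mono; rewrite ler_wpM2l // gerBl ltW.
apply: (@le_trans _ _ (\sum_(j < M2) 4 * 2 `^ (- (n%:R * (r.1 + r.2 - eta + delta))))).
  apply: ler_sum => j _.
  rewrite (cloud_marginal1 _ Q2_sum j (fun x x' => (D x x')%:R)).
  have cb := class_prob_X1X2 (D := D) (x1' := K0.1) (x2' := K0.2 j0) (y := y) n0 PXd.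
  apply: (@le_trans _ _ (4 * 2 `^ (- (n%:R * MI_X1X2Y (joint_type R K0.1 (K0.2 j0) y))))).
    apply: le_trans (ler_wpM2l _ (cb _)) => //; last first.
      by move=> x x' /forallP same p; apply/eqP.
    rewrite mulr_sumr; apply: ler_sum => x _; rewrite !mulr_sumr [leRHS]big_mkcond.
    apply: ler_sum => x' _; rewrite mulrA.
    by case: (D x x'); rewrite ?mulr1 ?mulr0 // Q12_le.
  rewrite ler_pM2l //; apply: powR2_mono; by rewrite lerN2 ler_pM2l ?ltr0n.
rewrite sumr_const card_ord -[_ *+ M2]mulr_natl mulrCA ler_pM2l //.
apply: le_trans (ler_wpM2r (powR_ge0 _ _) M2le) _.
rewrite -powR2D; apply: powR2_mono; rewrite le_eqVlt; apply/orP; left; apply/eqP; ring.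
Qed.

(** The numbers of rivals cancel the rates in [b] and [c], leaving [delta] in both exponents; 6 is
    the sum of their constants 2 and 4. *)
Lemma superposition_ensemble : ensemble W q n M1 M2
  (4 * (#|{: X1 * X2 * Y}|%:R / (d ^+ 2 * n%:R))
   + 6 * (ntypes * 2 `^ (- (n%:R * delta)))).
Proof.
have nt0 : 0 <= ntypes by rewrite ler0n.
set b := ntypes * (2 * 2 `^ (- (n%:R * (r.2 - eta + delta)))).
set c := ntypes * (4 * 2 `^ (- (n%:R * (r.1 - eta + delta)))).
have b0 : 0 <= b by rewrite !mulr_ge0 ?powR_ge0.
have c0 : 0 <= c by rewrite !mulr_ge0 ?powR_ge0.
have E := random_coding Wch M1 Q1_ge0 Q1_sum Q2_ge0 Q2_sum (T := T)
  atypical_bound satellite_bound cloud_bound b0 c0.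
apply: ensemble_le E; rewrite -addrA lerD2l.
have expE s : 2 `^ (n%:R * s) * 2 `^ (- (n%:R * (s + delta))) = 2 `^ (- (n%:R * delta)).
  by rewrite -powR2D; congr (_ `^ _); ring.
have -> : 6 * (ntypes * 2 `^ (- (n%:R * delta))) =
    2 `^ (n%:R * (r.2 - eta)) * b + 2 `^ (n%:R * (r.1 - eta)) * c.
  rewrite /b /c ![_ * (ntypes * _)]mulrCA ![2 `^ (n%:R * (_ - eta)) * (_ * _)]mulrCA !expE.
  ring.
by apply: lerD; apply: ler_wpM2r => //; apply: size_le_pred.
Qed.

End FixedBlocklength.

Lemma Rcog_ensemble_achievable (r : R * R) :
  Rcog q P r -> ensemble_achievable W q r.
Proof.
move=> rP; have [r10 [r20 _]] := rP; split => // eps eta eps0 eta0.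
have [d2 d20 g2] := gap2 Wch rP eta0; have [d1 d10 g0] := gap0 Wch rP eta0.
pose delta := Num.min d1 d2.
have delta0 : 0 < delta by rewrite lt_min d10.
have gap0P f : is_dist3 f -> slack0 W q PX f < delta ->
    (r.1 - eta + delta <= MI_X1Y f) \/ (r.1 + r.2 - eta + delta <= MI_X1X2Y f).
  rewrite lt_min => fd /andP[lt1 _]; have dle : delta <= d1 by rewrite ge_min lexx.
  by case: (g0 f fd lt1) => le; [left|right]; apply: le_trans le; rewrite lerD2l.
have gap2P f : is_dist3 f -> slack2 W q PX f < delta ->
    r.2 - eta + delta <= MI_X2Y_given_X1 f.
  rewrite lt_min => fd /andP[_ lt2]; apply: le_trans (g2 f fd lt2).
  by rewrite lerD2l ge_min lexx orbT.
have k0 : 0 <= slack_const q.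
  by rewrite !addr_ge0 //; do 3!apply: sumr_ge0 => ? _.
(* The [+ 1] keeps the denominator positive and makes [d * slack_const q] strictly less than
   [delta]. *)
pose d := delta / (slack_const q + 1).
have k1 : 0 < slack_const q + 1 by rewrite ltr_wpDl.
have d0 : 0 < d by rewrite divr_gt0.
have d_small : d * slack_const q < delta.
  by rewrite /d mulrAC ltr_pdivrMr // ltr_pM2l // ltrDl.
have [b0 _] : exists b : X2, true.
  apply: contrapT => noX2; have := PXd.2.
  rewrite big1 => [/eqP|a _]; first by rewrite eq_sym oner_eq0.
  by rewrite big1 // => b _; case: noX2; exists b.
(* Six times [eps / 12] is half of [eps]; [N3] leaves the other half to atypical outputs, and [N2]
   is the threshold of [restricted_law]. *)
have eps20 : 0 < eps / 12 by lra.
have [N1 h1] := poly_exp_small #|{: X1 * X2 * Y}| delta0 eps20.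
have [N2 h2] := exists_nat_ge (4 * #|{: X1 * X2}|%:R / d ^+ 2).
have [N3 h3] := exists_nat_ge (8 * #|{: X1 * X2 * Y}|%:R / (eps * d ^+ 2)).
exists (maxn 1 (maxn N1 (maxn N2 N3))) => n; rewrite !geq_max.
move=> /and4P[n0 n1 n2 n3] M1 M2 sz1 sz2.
have dd : 0 < d ^+ 2 by rewrite exprn_gt0.
have := h2 n n2; rewrite ler_pdivrMr // [n%:R * _]mulrC => big2.
have [Q1 [Q2 [[Q10 Q11] [Q20 Q21] Q1le Q2le]]] := restricted_law PXd n0 b0 d0 big2.
have E := superposition_ensemble n0 d0 eta0 r20 gap0P gap2P d_small
  sz1 sz2 Q10 Q11 Q20 Q21 Q1le Q2le.
apply: ensemble_le E; rewrite [leRHS]splitr; apply: lerD.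
  have np : 0 < d ^+ 2 * n%:R by rewrite mulr_gt0 // ltr0n.
  have := h3 n n3; rewrite ler_pdivrMr ?(mulr_gt0 eps0 dd) // => big3.
  rewrite mulrA ler_pdivrMr //; lra.
have := h1 n n1; lra.
Qed.

End Superposition.

Unset Implicit Arguments.

Theorem theorem3 (R : realType) (X1 X2 Y : finType)
    (W : X1 -> X2 -> Y -> R) (q : X1 -> X2 -> Y -> R) :
  is_channel W ->
  closure (conv_hull (union_Rcog W q)) `<=` capacity_region W q.
Proof.
move=> Wch; suff sub : conv_hull (union_Rcog W q) `<=` capacity_region W q.
  by move=> r /(closureS sub); exact: closed_closure.
move=> p pH.
have p_ach : ensemble_achievable W q p.
  apply: (conv_hull_ensemble_achievable Wch _ pH) => s [PX [PXd sP]].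
  exact: (Rcog_ensemble_achievable Wch PXd sP).
(* A convex combination has at least one term, and its input law has total mass 1, so both input
   alphabets are inhabited. *)
have [a0 [b0 _]] : exists (a : X1) (b : X2), true.
  case: pH => k [l [a [_ [l1 [aU _]]]]].
  case: k l a l1 aU => [|k] l a l1 aU.
    by move/eqP: l1; rewrite big_ord0 eq_sym oner_eq0.
  have [PX [[_ PX1] _]] := aU ord0; apply: contrapT => none; move: PX1.
  rewrite big1 => [/eqP|x _]; first by rewrite eq_sym oner_eq0.
  by rewrite big1 // => x' _; case: none; exists x, x'.
exact: (ensemble_achievable_capacity Wch a0 b0 p_ach).
Qed.
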